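(* Let $F$ be a valued field with valuation ring $V_F$, residue field $\bar F$ and canonical residue map $\pi_F:V_F\to\bar F$. Suppose that $V_F$ contains a field that maps isomorphically onto $\bar F$ under $\pi_F$. Then $F$ has the inertial lift property.
   Context: A valued field is a field $F$ with a fixed Krull valuation $v$. A valuation on a division ring $D$ is a map $v:D\to\Gamma\cup\{\infty\}$ ($\Gamma$ totally ordered abelian group) with $v(x)=\infty\iff x=0$, $v(xy)=v(x)+v(y)$, $v(x+y)\ge\min\{v(x),v(y)\}$, with residue division ring $\bar D=\{v\ge0\}/\{v>0\}$. A finite-dimensional valued division ring $E$ is inertial over a subfield $F\subseteq Z(E)$ if $[E:F]=[\bar E:\bar F]<\infty$ and $Z(\bar E)$ is separable over $\bar F$; $E$ is inertial if it is inertial over $Z(E)$. Inertial lift property: let $\mathcal D(F)$ be the set of finite-dimensional central division $F$-algebras and let $\mathrm{IBr}(F)$ be the set of $[D]\in\mathrm{Br}(F)$, $D\in\mathcal D(F)$, such that $v$ extends to a valuation on $D$ (necessarily unique) and $D$ is inertial; then $Z(\bar D)=\bar F$, giving a map $\beta_F:\mathrm{IBr}(F)\to\mathrm{Br}(\bar F)$, $[D]\mapsto[\bar D]$. $F$ has the inertial lift property if $\mathrm{IBr}(F)$ contains a subgroup $X$ of $\mathrm{Br}(F)$ that maps onto $\mathrm{Br}(\bar F)$ under $\beta_F$, and for every finite Galois extension $\widetilde K/\bar F$ there is a field $K$, Galois and inertial over $F$, with $\bar K\cong\widetilde K$ (over $\bar F$), such that for all $D\in\mathcal D(F)$ with $[D]\in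 X$ the valuation of $K$ extends to a valuation on the underlying division algebra $D_K$ of $D\otimes_F K$. *)

(* Defs.v *)
From HB Require Import structures.
From mathcomp Require Import all_boot all_order all_algebra all_field.

Set Implicit Arguments.
Unset Strict Implicit.
Unset Printing Implicit Defensive.

Import Order.TTheory GRing.Theory.

Local Open Scope ring_scope.

Section Algebras.
Variable F : fieldType.

Definition is_division (R : unitRingType) : Prop :=
  forall x : R, x != 0 -> x \is a GRing.unit.

Definition is_central (A : falgType F) : Prop := 'Z({:A})%VS = 1%VS.

(* A two-sided ideal of a unital algebra is automatically a subspace. *)
Definition is_simple (A : falgType F) : Prop :=
  forall I : {vspace A},
    ({:A} * I <= I)%VS -> (I * {:A} <= I)%VS -> I = 0%VS \/ I = {:A}%VS.

Definition central_simple (A : falgType F) : Prop := is_central A /\ is_simple A.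

Definition central_division (D : falgType F) : Prop :=
  is_division D /\ is_central D.

(* In the library ['M[A]_n] is an [A]-module, not an [F]-module; its structure
   of [F]-algebra is [c . M := c%:A *: M].  [matrix_over A D] says that
   [A] and [M_n(D)] are isomorphic [F]-algebras for some [n >= 1]. *)
Definition matrix_over (A D : falgType F) : Prop :=
  exists (n : nat) (phi : {rmorphism 'M[D]_n.+1 -> A}),
    bijective phi /\ forall (c : F) M, phi (c%:A *: M) = c *: phi M.

(* Brauer equivalence: [M_m(A)] and [M_n(B)] are isomorphic [F]-algebras for
   some [m, n >= 1]. *)
Definition brauer_equiv (A B : falgType F) : Prop :=
  exists (m n : nat) (phi : {rmorphism 'M[A]_m.+1 -> 'M[B]_n.+1}),
    bijective phi /\ forall (c : F) M, phi (c%:A *: M) = c%:A *: phi M.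

End Algebras.

Section OppositeAlgebra.
Variables (F : fieldType) (A : falgType F).

HB.instance Definition _ := GRing.Zmodule_isLmodule.Build F A^c
  (@scalerA F A) (@scale1r F A) (@scalerDr F A) (fun v a b => scalerDl v a b).

Fact opp_scalerAl (c : F) (x y : A^c) : c *: (x * y) = c *: x * y.
Proof. exact: (@scalerAr F A c y x). Qed.
HB.instance Definition _ := GRing.Lmodule_isLalgebra.Build F A^c opp_scalerAl.

Fact opp_scalerAr (c : F) (x y : A^c) : c *: (x * y) = x * (c *: y).
Proof. exact: (@scalerAl F A c y x). Qed.
HB.instance Definition _ := GRing.Lalgebra_isAlgebra.Build F A^c opp_scalerAr.

Fact opp_vect_iso : SemiVector.axiom (dim A) A^c.
Proof.
have [f [fZ fD] fB] := VectorInternalTheory.v2r_subproof A.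
exact: (@Build_semivector_axiom_def F (dim A) A^c f (conj fZ fD) fB).
Qed.
HB.instance Definition _ := LSemiModule_hasFinDim.Build F A^c opp_vect_iso.

End OppositeAlgebra.

(* [tensor A B] is [A (x)_F B]; its elements are written uniquely as
   [\sum_i e_i (x) x_i], with [e_i] the [i]-th element of [vbasis {:A}] and
   [x_i : B]. *)
Definition tensor (F : fieldType) (A B : falgType F) : Type :=
  {ffun 'I_(\dim {:A}) -> B}.

Section Tensor.
Variables (F : fieldType) (A B : falgType F).
Local Notation T := (tensor A B).
Local Notation e := (vbasis {:A}).

HB.instance Definition _ := Vector.copy T {ffun 'I_(\dim {:A}) -> B}.

Definition pure_tensor (a : A) (b : B) : T := [ffun i => coord e i a *: b].
Local Notation "a '\ox' b" := (pure_tensor a b) (at level 40).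

Definition tensor_one : T := 1 \ox 1.
Definition tensor_mul (x y : T) : T :=
  \sum_(i < \dim {:A}) \sum_(j < \dim {:A}) (e`_i * e`_j) \ox (x i * y j).

Lemma pure_tensorDl a a' b : (a + a') \ox b = a \ox b + a' \ox b.
Proof. by apply/ffunP=> i; rewrite !ffunE linearD scalerDl. Qed.
Lemma pure_tensorDr a b b' : a \ox (b + b') = a \ox b + a \ox b'.
Proof. by apply/ffunP=> i; rewrite !ffunE scalerDr. Qed.
Lemma pure_tensorZl (c : F) a b : (c *: a) \ox b = c *: (a \ox b).
Proof. by apply/ffunP=> i; rewrite !ffunE linearZ scalerA. Qed.
Lemma pure_tensorZr (c : F) a b : a \ox (c *: b) = c *: (a \ox b).
Proof. by apply/ffunP=> i; rewrite !ffunE !scalerA mulrC. Qed.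

Lemma pure_tensor_suml I (r : seq I) P (E : I -> A) b :
  (\sum_(i <- r | P i) E i) \ox b = \sum_(i <- r | P i) (E i \ox b).
Proof.
apply: (big_morph (pure_tensor^~ b)) => [a a'|]; first exact: pure_tensorDl.
by rewrite -(scale0r 0) pure_tensorZl scale0r.
Qed.

Lemma tensor_sum (x : T) : x = \sum_(i < \dim {:A}) e`_i \ox x i.
Proof.
apply/ffunP=> k; rewrite sum_ffunE (bigD1 k) //= big1 ?addr0 => [|i /negPf nik].
  by rewrite ffunE coord_free ?(basis_free (vbasisP _)) // eqxx scale1r.
by rewrite ffunE coord_free ?(basis_free (vbasisP _)) // nik scale0r.
Qed.

Lemma pure_tensor_sum a b : a \ox b = \sum_(i < \dim {:A}) e`_i \ox (coord e i a *: b).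
Proof. by rewrite [LHS]tensor_sum; apply: eq_bigr => i _; rewrite ffunE. Qed.

Lemma tensor_mulDl : left_distributive tensor_mul +%R.
Proof.
move=> x y z; rewrite -big_split; apply: eq_bigr => i _.
rewrite -big_split; apply: eq_bigr => j _.
by rewrite ffunE mulrDl pure_tensorDr.
Qed.

Lemma tensor_mulDr : right_distributive tensor_mul +%R.
Proof.
move=> x y z; rewrite -big_split; apply: eq_bigr => i _.
rewrite -big_split; apply: eq_bigr => j _.
by rewrite ffunE mulrDr pure_tensorDr.
Qed.

Lemma tensor_mulZl (c : F) x y : tensor_mul (c *: x) y = c *: tensor_mul x y.
Proof.
rewrite scaler_sumr; apply: eq_bigr => i _; rewrite scaler_sumr.
by apply: eq_bigr => j _; rewrite ffunE -scalerAl pure_tensorZr.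
Qed.

Lemma tensor_mulZr (c : F) x y : tensor_mul x (c *: y) = c *: tensor_mul x y.
Proof.
rewrite scaler_sumr; apply: eq_bigr => i _; rewrite scaler_sumr.
by apply: eq_bigr => j _; rewrite ffunE -scalerAr pure_tensorZr.
Qed.

Lemma pure_tensorM a a' b b' :
  tensor_mul (a \ox b) (a' \ox b') = (a * a') \ox (b * b').
Proof.
rewrite {2}(coord_vbasis (memvf a)) {2}(coord_vbasis (memvf a')) mulr_suml.
rewrite pure_tensor_suml; apply: eq_bigr => i _.
rewrite mulr_sumr pure_tensor_suml; apply: eq_bigr => j _.
rewrite !ffunE -!(scalerAl, scalerAr).
by rewrite !(pure_tensorZl, pure_tensorZr) !scalerA.
Qed.

Lemma tensor_suml I (r : seq I) P (E : I -> T) y :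
  tensor_mul (\sum_(i <- r | P i) E i) y = \sum_(i <- r | P i) tensor_mul (E i) y.
Proof.
apply: (big_morph (tensor_mul^~ y)) => [x z|]; first exact: tensor_mulDl.
by rewrite -[X in tensor_mul X](scale0r (0 : T)) tensor_mulZl scale0r.
Qed.

Lemma tensor_sumr I (r : seq I) P (E : I -> T) y :
  tensor_mul y (\sum_(i <- r | P i) E i) = \sum_(i <- r | P i) tensor_mul y (E i).
Proof.
apply: (big_morph (tensor_mul y)) => [x z|]; first exact: tensor_mulDr.
by rewrite -[X in tensor_mul _ X](scale0r (0 : T)) tensor_mulZr scale0r.
Qed.

Fact tensor_mulA : associative tensor_mul.
Proof.
have sumE u : exists U, u = \sum_(i < \dim {:A}) e`_i \ox U i.
  by exists u; apply: tensor_sum.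
move: tensor_suml tensor_sumr pure_tensorM; move: tensor_mul => m suml sumr mE.
move=> x y z; have [X ->] := sumE x; rewrite !suml; apply: eq_bigr => i _.
have [Y ->] := sumE y; rewrite suml !sumr suml; apply: eq_bigr => j _.
have [Z ->] := sumE z; rewrite !sumr; apply: eq_bigr => k _.
by rewrite !mE !mulrA.
Qed.

Fact tensor_mul1l : left_id tensor_one tensor_mul.
Proof.
move=> x; rewrite (tensor_sum x) tensor_sumr; apply: eq_bigr => i _.
by rewrite pure_tensorM !mul1r.
Qed.

Fact tensor_mul1r : right_id tensor_one tensor_mul.
Proof.
move=> x; rewrite (tensor_sum x) tensor_suml; apply: eq_bigr => i _.
by rewrite pure_tensorM !mulr1.
Qed.

Fact tensor_one_neq0 : tensor_one != 0.
Proof.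
apply/eqP=> /ffunP one0; have /eqP[] := oner_neq0 A.
rewrite (coord_vbasis (memvf 1)) big1 // => i _.
have /eqP := one0 i; rewrite !ffunE scaler_eq0 oner_eq0 orbF => /eqP->.
by rewrite scale0r.
Qed.

HB.instance Definition _ := GRing.Zmodule_isNzRing.Build T
  tensor_mulA tensor_mul1l tensor_mul1r tensor_mulDl tensor_mulDr tensor_one_neq0.
HB.instance Definition _ := GRing.Lmodule_isLalgebra.Build F T
  (fun c x y => esym (tensor_mulZl c x y)).
HB.instance Definition _ := GRing.Lalgebra_isAlgebra.Build F T
  (fun c x y => esym (tensor_mulZr c x y)).
HB.instance Definition _ := Algebra_isFalgebra.Build F T.

End Tensor.

(* [base_change A K] is the ring [A (x)_F K], seen as an algebra over [K]
   through [c . (a (x) b) = a (x) (c * b)]. *)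
Definition base_change (F : fieldType) (A : falgType F) (K : fieldExtType F) :
  Type := tensor A K.

Section BaseChange.
Variables (F : fieldType) (A : falgType F) (K : fieldExtType F).
Local Notation AK := (base_change A K).

HB.instance Definition _ := GRing.NzRing.copy AK (tensor A K).

Definition base_change_scale (c : K) (x : AK) : AK := [ffun i => c * x i].

Fact base_change_scaleA c d x :
  base_change_scale c (base_change_scale d x) = base_change_scale (c * d) x.
Proof. by apply/ffunP=> i; rewrite !ffunE mulrA. Qed.
Fact base_change_scale1 : left_id 1 base_change_scale.
Proof. by move=> x; apply/ffunP=> i; rewrite !ffunE mul1r. Qed.
Fact base_change_scaleDr : right_distributive base_change_scale +%R.
Proof. by move=> c x y; apply/ffunP=> i; rewrite !ffunE mulrDr. Qed.
Fact base_change_scaleDl x : {morph base_change_scale^~ x : c d / c + d}.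
Proof. by move=> c d; apply/ffunP=> i; rewrite !ffunE mulrDl. Qed.
HB.instance Definition _ := GRing.Zmodule_isLmodule.Build K AK
  base_change_scaleA base_change_scale1 base_change_scaleDr base_change_scaleDl.

Lemma base_change_pure (c : K) a b :
  c *: (pure_tensor a b : AK) = pure_tensor a (c * b).
Proof. by apply/ffunP=> i; rewrite !ffunE scalerAr. Qed.

Fact base_change_scalerAl (c : K) (x y : AK) : c *: (x * y) = c *: x * y.
Proof.
rewrite scaler_sumr; apply: eq_bigr => i _; rewrite scaler_sumr.
by apply: eq_bigr => j _; rewrite base_change_pure ffunE mulrA.
Qed.
HB.instance Definition _ :=
  GRing.Lmodule_isLalgebra.Build K AK base_change_scalerAl.

Fact base_change_scalerAr (c : K) (x y : AK) : c *: (x * y) = x * (c *: y).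
Proof.
rewrite scaler_sumr; apply: eq_bigr => i _; rewrite scaler_sumr.
by apply: eq_bigr => j _; rewrite base_change_pure ffunE mulrCA.
Qed.
HB.instance Definition _ :=
  GRing.Lalgebra_isAlgebra.Build K AK base_change_scalerAr.

Fact base_change_vect_iso :
  SemiVector.axiom (dim {ffun 'I_(\dim {:A}) -> K^o}) AK.
Proof.
have [f [fZ fD] fB] :=
  VectorInternalTheory.v2r_subproof {ffun 'I_(\dim {:A}) -> K^o}.
exact: (@Build_semivector_axiom_def K _ AK f (conj fZ fD) fB).
Qed.
HB.instance Definition _ := LSemiModule_hasFinDim.Build K AK base_change_vect_iso.
HB.instance Definition _ := Algebra_isFalgebra.Build K AK.

End BaseChange.

(* Br(F) is the set of Brauer classes of central simple [F]-algebras, with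
   [A][B] = [A (x) B], 1 = [F] and [A]^-1 = [A^c].  A subset of Br(F) is
   given as a predicate on central simple algebras that is invariant under
   Brauer equivalence: [X A] means that the class of [A] is in the subset. *)
Record brauer_subgroup (F : fieldType) (X : falgType F -> Prop) : Prop := {
  brauer_subgroup_csa : forall A, X A -> central_simple A;
  brauer_subgroup_equiv : forall A B,
    X A -> central_simple B -> brauer_equiv A B -> X B;
  brauer_subgroup1 : X F^o;
  brauer_subgroupM : forall A B, X A -> X B -> X (tensor A B);
  brauer_subgroupV : forall A, X A -> X A^c }.

(* The division algebra [E], with center [K], underlying the central simple
   [K]-algebra [A]; it is unique up to isomorphism. *)
Definition underlying_division (K : fieldType) (A E : falgType K) : Prop :=
  is_division E /\ matrix_over A E.

Record ordered_group := OrderedGroup {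
  ordered_group_sort :> porderZmodType;
  ordered_group_total : total (@Order.le _ ordered_group_sort);
  ordered_group_leD : forall x y z : ordered_group_sort,
    x <= y -> x + z <= y + z }.

(* The set [G] with a largest element [oo] added is [option G], with
   [oo = None]. *)
Section ValueGroup.
Variable G : ordered_group.
Implicit Types x y : option G.

Definition vadd x y : option G :=
  if x is Some a then if y is Some b then Some (a + b) else None else None.
Definition vle x y : bool :=
  if y is Some b then if x is Some a then a <= b else false else true.
Definition vlt x y : bool := ~~ vle y x.
Definition vmin x y : option G := if vle x y then x else y.

End ValueGroup.

Record valuation (R : nzRingType) (G : ordered_group) := Valuation {
  valuation_fun :> R -> option G;
  valuation_eq0 : forall x, valuation_fun x = None <-> x = 0;
  valuationM : forall x y,
    valuation_fun (x * y) = vadd (valuation_fun x) (valuation_fun y);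
  valuationD : forall x y,
    vle (vmin (valuation_fun x) (valuation_fun y)) (valuation_fun (x + y)) }.

Definition val_ring (R : nzRingType) (G : ordered_group) (v : valuation R G) :
  {pred R} := [pred x | vle (Some 0) (v x)].

Definition val_ideal (R : nzRingType) (G : ordered_group) (v : valuation R G) :
  {pred R} := [pred x | vlt (Some 0) (v x)].

(* [pi] is the residue map [{v >= 0} -> {v >= 0} / {v > 0}], up to a unique
   isomorphism of [S] with the quotient.  Only the values of [pi] on
   [{v >= 0}] matter. *)
Record residue_map (R S : nzRingType) (G : ordered_group) (v : valuation R G)
    (pi : R -> S) : Prop := {
  residue1 : pi 1 = 1;
  residueD : {in val_ring v &, {morph pi : x y / x + y}};
  residueM : {in val_ring v &, {morph pi : x y / x * y}};
  residue_ker : {in val_ring v, forall x, pi x = 0 <-> x \in val_ideal v};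
  residue_surj : forall y : S, exists2 x, x \in val_ring v & pi x = y }.

(* The value group of [w] may be larger than that of [v]. *)
Definition val_extends (F : fieldType) (G : ordered_group) (v : valuation F G)
    (E : falgType F) (H : ordered_group) (w : valuation E H) : Prop :=
  exists iota : {additive G -> H},
    {mono iota : x y / x <= y} /\ forall a : F, w a%:A = omap iota (v a).

(* Used when [A] is a division algebra, whose center is a field: [L] is that
   center. *)
Definition center_separable (k : fieldType) (A : falgType k) : Prop :=
  exists (L : fieldExtType k) (f : {lrmorphism L -> A}),
    (forall x, x \in 'Z({:A})%VS <-> exists z, f z = x) /\ separable 1 {:L}.

(* [v] is a valuation on [F] with residue field [k] and residue map [pi], and
   [E] is a division algebra with valuation [w] extending [v], residue division
   ring [Ebar] and residue map [piE]; [residue_compat] says that the structure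
   of [k]-algebra on [Ebar] is the one induced by the inclusion of [F] in [E]. *)
Record inertial_over (F k : fieldType) (G : ordered_group) (v : valuation F G)
    (pi : F -> k) (E : falgType F) (Ebar : falgType k) (H : ordered_group)
    (w : valuation E H) (piE : E -> Ebar) : Prop := {
  inertial_division : is_division E;
  inertial_extends : val_extends v w;
  inertial_residue : residue_map w piE;
  residue_compat : {in val_ring v, forall a, piE a%:A = (pi a)%:A};
  inertial_dim : \dim {:E} = \dim {:Ebar};
  inertial_separable : center_separable Ebar }.

(* The class of [D] is in IBr(F) and beta_F maps it to the class of [Dbar]. *)
Definition in_IBr (F k : fieldType) (G : ordered_group) (v : valuation F G)
    (pi : F -> k) (D : falgType F) (Dbar : falgType k) : Prop :=
  central_division D /\
  exists (H : ordered_group) (w : valuation D H) (piD : D -> Dbar),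
    inertial_over v pi w piD.

(* The field [K], Galois and inertial over [F], is given with its valuation [w]
   and with [Kt] itself as a model of its residue field. *)
Definition inertial_lift_property (F k : fieldType) (G : ordered_group)
    (v : valuation F G) (pi : F -> k) : Prop :=
  exists X : falgType F -> Prop,
  [/\ brauer_subgroup X,
      forall D, central_division D -> X D -> exists Dbar, in_IBr v pi D Dbar,
      forall B, central_simple B ->
        exists D Dbar, [/\ X D, in_IBr v pi D Dbar & brauer_equiv Dbar B]
    & forall Kt : splittingFieldType k, galois 1 {:Kt} ->
        exists (K : splittingFieldType F) (H : ordered_group)
               (w : valuation K H) (piK : K -> Kt),
        [/\ galois 1 {:K}, inertial_over v pi w piK
          & forall D, central_division D -> X D ->
              exists DK : falgType K,
                underlying_division (base_change D K) DK /\
                exists (H' : ordered_group) (w' : valuation DK H'),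
                  val_extends w w']].

(* Main.v *)
Require Import Defs.
From HB Require Import structures.
From Stdlib Require Import Classical_Prop.
From mathcomp Require Import all_boot all_order all_algebra all_field.

Set Implicit Arguments.
Unset Strict Implicit.
Unset Printing Implicit Defensive.

Import Order.TTheory GRing.Theory.

Local Open Scope ring_scope.

(** Write [s : k -> F] for the section of the residue map whose image is the
    field [L]; every nonzero element of [k] is sent by [s] to a unit of the
    valuation ring.  The subgroup [X] of [Br(F)] is the image of the scalar
    extension map [Br(k) -> Br(F)], [B |-> B (x)_k F], along [s].

    Everything rests on one computation.  Let [B] be a finite-dimensional
    division algebra over [k], with basis [e_i].  On [A = B (x)_k F] put
    [w (\sum x_i e_i) = min v(x_i)].  The elements of value at least [0] reduce
    to [B] through [\sum x_i e_i |-> \sum pi(x_i) e_i], which is multiplicative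
    because the structure constants of [A] lie in [s(k)].  Two nonzero elements
    can be scaled by [F] so as to have value [0], hence nonzero residues, and
    the product of their residues is not [0] since [B] is a division ring: so
    [w] is multiplicative.  Thus [A] is a division algebra, [w] extends [v],
    and [B] is its residue algebra (section [FormValuation]).

    Consequently [X] maps onto [Br(k)], and a division algebra in [X] is
    inertial with residue algebra its own [k]-form.  For a Galois extension
    [Kt] of [k] one takes [K = Kt (x)_k F], which is a field by the same
    computation and is generated by the roots of the same separable polynomial.
    For [D = B (x)_k F] in [X], the algebra [D (x)_F K] is
    [(B (x)_k Kt) (x)_Kt K]; if [C] is the division algebra underlying
    [B (x)_k Kt], the division algebra underlying [D (x)_F K] is [C (x)_Kt K],
    which has a valuation extending that of [K], by the computation applied to
    the valued field [K] and its residue section [Kt -> K].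

    It remains to know that [X] is a subgroup made of whole Brauer classes.
    This takes some classical theory of simple algebras: the density theorem
    ([density]), from which the simplicity and the centrality of tensor
    products and of forms follow, and the theorem that a corner of a simple
    ring is a matrix algebra over any of its division corners
    ([corner_matrix]), which contains Wedderburn's theorem and also compares
    Brauer equivalent algebras. *)

(** * Multiplication maps and simplicity *)

Definition sandwich (R : nzRingType) (s : seq (R * R)) (x : R) : R :=
  \sum_(t <- s) t.1 * x * t.2.

(** Being a statement about elements only, simplicity in this form does not
    see the field of scalars: it passes from [tensor A K] over [F] to
    [base_change A K] over [K] for free. *)
Definition ring_simple (R : nzRingType) : Prop :=
  forall x : R, x != 0 -> exists s, sandwich s x = 1.

(** Membership in the multiplication algebra, generated by the left and the
    right multiplications. *)
Definition mul_map (R : nzRingType) (f : R -> R) : Prop :=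
  exists s, forall x, f x = sandwich s x.

Section MulMaps.
Variable R : nzRingType.
Implicit Types (f g : R -> R) (s : seq (R * R)).

Lemma sandwich_is_additive s : additive (sandwich s).
Proof.
by move=> x y; rewrite -sumrB; apply: eq_bigr => t _; rewrite mulrBr mulrBl.
Qed.
HB.instance Definition _ s :=
  GRing.isZmodMorphism.Build R R (sandwich s) (sandwich_is_additive s).

Lemma mul_map_sandwich s : mul_map (sandwich s).
Proof. by exists s. Qed.

Lemma mul_map0 : mul_map (fun=> 0 : R).
Proof. by exists [::] => x; rewrite /sandwich big_nil. Qed.

Lemma mul_mapD f g : mul_map f -> mul_map g -> mul_map (fun x => f x + g x).
Proof.
by case=> s fE [t gE]; exists (s ++ t) => x; rewrite /sandwich big_cat fE gE.
Qed.

Lemma mul_mapLR a b f : mul_map f -> mul_map (fun x => a * f x * b).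
Proof.
case=> s fE; exists [seq (a * t.1, t.2 * b) | t <- s] => x.
rewrite fE /sandwich big_map mulr_sumr mulr_suml.
by apply: eq_bigr => t _; rewrite !mulrA.
Qed.

Lemma mul_mapL a f : mul_map f -> mul_map (fun x => a * f x).
Proof.
by move=> /(mul_mapLR a 1)[s fE]; exists s => x; rewrite -fE mulr1.
Qed.

Lemma mul_mapR a f : mul_map f -> mul_map (fun x => f x * a).
Proof.
by move=> /(mul_mapLR 1 a)[s fE]; exists s => x; rewrite -fE mul1r.
Qed.

Lemma mul_mapN f : mul_map f -> mul_map (fun x => - f x).
Proof.
by move=> /(mul_mapL (-1))[s fE]; exists s => x; rewrite -fE mulN1r.
Qed.

Lemma mul_map_comp s f : mul_map f -> mul_map (fun x => sandwich s (f x)).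
Proof.
move=> fM; elim: s => [|t s IHs].
  by case: mul_map0 => s' s'E; exists s' => x; rewrite -s'E /sandwich big_nil.
case: (mul_mapD (mul_mapLR t.1 t.2 fM) IHs) => s' s'E.
by exists s' => x; rewrite -s'E /sandwich big_cons.
Qed.

End MulMaps.

Lemma span_ind (F : fieldType) (V : vectType F) (X : seq V) (P : V -> Prop) :
    P 0 -> (forall x y, P x -> P y -> P (x + y)) ->
    (forall c x, x \in X -> P (c *: x)) ->
  forall v, v \in <<X>>%VS -> P v.
Proof.
move=> P0 PD PX v Xv; rewrite (coord_span (X := in_tuple X) Xv).
elim/big_ind: _ => // i _; apply: PX; exact/mem_nth.
Qed.

Section SimpleAlgebras.
Variables (F : fieldType) (A : falgType F).

Lemma centralP : is_central A <->
  forall z : A, (forall a, z * a = a * z) -> exists c : F, z = c%:A.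
Proof.
split=> [ZA z cz | ZA].
  apply/vlineP; rewrite -[<[1]>%VS]ZA memv_cap memvf.
  by apply/centvP=> a _; apply: cz.
apply/eqP; rewrite eqEsubv; apply/andP; split; apply/subvP=> z.
  rewrite memv_cap => /andP[_ /centvP cz].
  by apply/vlineP; apply: ZA => a; apply/cz/memvf.
case/vlineP=> c ->; rewrite memv_cap memvf.
by apply/centvP=> a _; rewrite mulr_algl mulr_algr.
Qed.

Lemma is_simpleP : is_simple A <-> ring_simple A.
Proof.
split=> [sA x nz_x | sA I].
  pose I := ({:A} * <[x]> * {:A})%VS.
  have Ix: x \in I.
    rewrite -[x]mulr1; apply: memv_mul (memvf _).
    by rewrite -{1}[x]mul1r; apply: memv_mul (memvf _) (memv_line _).
  have [] := sA I.
  - by rewrite /I !prodvA !prodvSl ?subvf.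
  - by rewrite /I -!prodvA !prodvSr ?subvf.
  - by move=> I0; rewrite I0 memv0 (negPf nz_x) in Ix.
  move=> If; have: 1 \in I by rewrite If memvf.
  suffices sandI: forall y, y \in I -> exists s, sandwich s x = y by move/sandI.
  rewrite /I; set J := ({:A} * <[x]>)%VS; rewrite unlock.
  apply: span_ind => [|y z [s <-] [t <-]|c y].
  - by exists [::]; rewrite /sandwich big_nil.
  - by exists (s ++ t); rewrite /sandwich big_cat.
  case/allpairsP=> -[u b] /= [/vbasis_mem/memv_cosetP[a _ ->] _ ->].
  by exists [:: (c *: a, b)]; rewrite /sandwich big_seq1 /= -!scalerAl.
move=> sAI sIA; have [-> | ] := eqVneq I 0%VS; first by left.
rewrite -vpick0 => nz_x; right; apply/eqP; rewrite eqEsubv subvf.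
have [s s1] := sA _ nz_x.
have I1: 1 \in I.
  rewrite -s1; apply: memv_suml => t _.
  apply: (subvP sIA); apply: memv_mul (memvf _).
  by apply: (subvP sAI); apply: memv_mul (memvf _) (memv_pick _).
apply/subvP=> a _; apply: (subvP sAI); rewrite -[a]mulr1.
exact: memv_mul (memvf _) I1.
Qed.

Lemma division_ring_simple (D : unitRingType) : is_division D -> ring_simple D.
Proof.
move=> divD x /divD Ux; exists [:: (x^-1, 1)].
by rewrite /sandwich big_seq1 /= mulVr ?mul1r.
Qed.

Lemma domain_division :
  (forall x y : A, x * y = 0 -> x = 0 \/ y = 0) -> is_division A.
Proof.
move=> domA x; apply: Falgebra_FieldMixin => {}x y /domA.
by case=> ->; rewrite eqxx ?orbT.
Qed.

Lemma division_domain (D : unitRingType) (x y : D) :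
  is_division D -> x * y = 0 -> x = 0 \/ y = 0.
Proof.
move=> divD xy0; have [|/divD Ux] := eqVneq x 0; first by left.
by right; apply: (mulrI Ux); rewrite mulr0.
Qed.

Lemma sandwichZ (t : seq (A * A)) (c : F) (x : A) :
  sandwich t (c *: x) = c *: sandwich t x.
Proof.
rewrite /sandwich scaler_sumr; apply: eq_bigr => p _.
by rewrite scalerAl scalerAr.
Qed.

(** The Jacobson density theorem for [A] as a module over its multiplication
    algebra, whose endomorphism ring is the center [F].  Given that [y] can be
    moved to [1] while killing [X], the inductive step kills one more vector
    [z]: if [z |-> 1] while [X |-> 0] and [y |-> c], either [c] is not central
    and a commutator with [c] kills [z] but not [y], or [c] is a scalar and
    the problem reduces to the vector [y - c z]. *)
Lemma density : is_central A -> ring_simple A ->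
  forall (U : {vspace A}) y, y \notin U ->
  exists s, sandwich s y = 1 /\ {in U, forall x, sandwich s x = 0}.
Proof.
move=> /centralP ZA sA U.
have mono f y (W : {vspace A}) :
    mul_map f -> f y != 0 -> {in W, forall x, f x = 0} ->
    exists s, sandwich s y = 1 /\ {in W, forall x, sandwich s x = 0}.
  move=> fM /sA[s s1] f0; have [s' s'E] := mul_map_comp s fM.
  by exists s'; rewrite -s'E; split=> // x /f0 fx0; rewrite -s'E fx0 raddf0.
rewrite -(span_basis (vbasisP U)); move: (tval _) => X {U}.
elim: X => [|z X IHX] y.
  rewrite span_nil memv0 => /sA[s s1]; exists s; split=> // x.
  by rewrite memv0 => /eqP->; rewrite raddf0.
rewrite span_cons => zXy.
have [Xz | /IHX[s [sz s0]]] := boolP (z \in <<X>>%VS).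
  have zX: (<[z]> <= <<X>>)%VS by rewrite -memvE.
  by move: zXy; rewrite (addv_idPr zX) => /IHX.
have in_zX (f : {additive A -> A}) : (forall c, f (c *: z) = 0) ->
    {in <<X>>%VS, forall x, f x = 0} ->
    {in (<[z]> + <<X>>)%VS, forall x, f x = 0}.
  move=> fz0 fX0 _ /memv_addP[_ /vlineP[c ->] [x Xx ->]].
  by rewrite raddfD /= fz0 fX0 // addr0.
have [zc | ] := boolP (sandwich s y \in 'Z({:A})%VS); last first.
  rewrite memv_cap memvf => /centvP ncy.
  have [a nca] : exists a, a * sandwich s y - sandwich s y * a != 0.
    move: ncy; set c := sandwich s y => ncy.
    have : ~~ ({:A} <= 'C[c])%VS by rewrite subv_cent1; apply/centvP.
    by case/subvPn=> a _ /cent1vP/eqP nca; exists a; rewrite subr_eq0.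
  pose f x := a * sandwich s x - sandwich s x * a.
  have fM: mul_map f.
    apply: mul_mapD (mul_mapL _ (mul_map_sandwich _)) _.
    exact/mul_mapN/mul_mapR/mul_map_sandwich.
  apply: (mono f) => // _ /memv_addP[_ /vlineP[c ->] [x Xx ->]].
  rewrite /f !(raddfD, sandwichZ) /= sandwichZ sz s0 // addr0.
  by rewrite -scalerAl -scalerAr mulr1 mul1r subrr.
have [c yE] : exists c : F, sandwich s y = c%:A.
  apply: ZA => a; move: zc; rewrite memv_cap => /andP[_ /centvP]; apply.
  exact: memvf.
have /IHX[t [ty t0]] : y - c *: z \notin <<X>>%VS.
  apply: contra zXy => Xy; rewrite -(subrK (c *: z) y) addrC.
  by apply: memv_add => //; rewrite memvZ ?memv_line.
pose f x := sandwich t x - sandwich t z * sandwich s x.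
have fM: mul_map f.
  apply: mul_mapD (mul_map_sandwich _) _.
  exact/mul_mapN/mul_mapL/mul_map_sandwich.
apply: (mono f) => //.
  by move: ty; rewrite raddfB /= sandwichZ /f yE mulr_algr => ->; apply: oner_neq0.
move=> _ /memv_addP[_ /vlineP[d ->] [x Xx ->]].
rewrite /f !raddfD /= !sandwichZ (s0 x Xx) (t0 x Xx) sz !addr0.
by rewrite mulr_algr subrr.
Qed.

(** The form in which density is used: multiplication maps of [A] compute the
    coordinates in [vbasis {:A}], also in an algebra obtained from [A] by
    extending the coefficients. *)
Lemma isolate_vbasis : is_central A -> ring_simple A ->
  forall i : 'I_(\dim {:A}), exists s, sandwich s (vbasis {:A})`_i = 1 /\
    forall l : 'I_(\dim {:A}), l != i -> sandwich s (vbasis {:A})`_l = 0.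
Proof.
move=> cA sA i; set e := vbasis _.
pose U := <<[seq e`_j | j : 'I_(\dim {:A}) <- enum 'I_(\dim {:A}) & j != i]>>%VS.
have Ui: e`_i \notin U.
  have frE: free e by apply: basis_free (vbasisP _).
  apply/negP => Ui; suffices: coord e i e`_i = 0.
    by rewrite coord_free // eqxx => /eqP; rewrite oner_eq0.
  move: Ui; apply: (span_ind (P := fun y => coord e i y = 0)) => [|y z y0 z0|c y].
  - exact: linear0.
  - by rewrite linearD /= y0 z0 addr0.
  case/mapP=> j; rewrite mem_filter => /andP[ne_ji _] ->.
  by rewrite linearZ /= coord_free // (negPf ne_ji) mulr0.
have [s [s1 s0]] := density cA sA Ui; exists s; split=> // l ne_l.
by apply/s0/memv_span/map_f; rewrite mem_filter ne_l mem_enum.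
Qed.

End SimpleAlgebras.

Section TensorSimple.
Variables (F : fieldType) (A B : falgType F).
Local Notation e := (vbasis {:A}).
Local Notation "a '\ox' b" := (pure_tensor a b : tensor A B) (at level 40).

Lemma pure_tensor_mul (a a' : A) (b b' : B) :
  (a \ox b) * (a' \ox b') = (a * a') \ox (b * b').
Proof. exact: pure_tensorM. Qed.

Lemma pure_tensor0l b : 0 \ox b = 0.
Proof. by rewrite -(scale0r 0) pure_tensorZl scale0r. Qed.

Lemma pure_tensor_inj1 (a : A) : a \ox 1 = 0 -> a = 0.
Proof.
move/ffunP=> a0; rewrite (coord_vbasis (memvf a)) big1 // => i _.
have /eqP := a0 i; rewrite !ffunE scaler_eq0 oner_eq0 orbF => /eqP->.
by rewrite scale0r.
Qed.

Lemma sandwich_tensor_suml s (x : tensor A B) :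
  sandwich [seq (t.1 \ox 1, t.2 \ox 1) | t <- s] x
    = \sum_(i < \dim {:A}) sandwich s e`_i \ox x i.
Proof.
rewrite /sandwich big_map; under [RHS]eq_bigr do rewrite pure_tensor_suml.
rewrite [RHS]exchange_big; apply: eq_bigr => t _ /=.
rewrite {1}[x]tensor_sum mulr_sumr mulr_suml; apply: eq_bigr => i _.
by rewrite !pure_tensor_mul mul1r mulr1.
Qed.

(** Density isolates a nonzero coordinate [b] of [x], so that the ideal
    generated by [x] contains [1 (x) b]; then simplicity of [B] gives [1]. *)
Lemma tensor_simple : is_central A -> ring_simple A -> ring_simple B ->
  ring_simple (tensor A B).
Proof.
move=> cA sA sB x nz_x.
have [i nz_xi] : exists i, x i != 0.
  apply/existsP; apply: contraR nz_x => /existsPn x0.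
  by apply/eqP/ffunP=> i; rewrite ffunE; apply/eqP/negbNE/x0.
have [s [s1 s0]] := isolate_vbasis cA sA i; have [t t1] := sB _ nz_xi.
pose s' := [seq ((p.1 \ox 1), (p.2 \ox 1)) | p <- s].
pose t' := [seq ((1 \ox p.1), (1 \ox p.2)) | p <- t].
have [r rE] := mul_map_comp t' (mul_map_sandwich s').
exists r; rewrite -rE sandwich_tensor_suml (bigD1 i) //= s1 big1 ?addr0.
  rewrite /sandwich big_map -[RHS]/(1 \ox 1) -t1.
  rewrite [RHS](big_morph (pure_tensor 1) (@pure_tensorDr _ _ _ 1) (id1 := 0)).
    by apply: eq_bigr => p _; rewrite !pure_tensor_mul !mulr1.
  by rewrite -(scale0r 0) pure_tensorZr scale0r.
by move=> j ne_ji; rewrite s0 ?pure_tensor0l.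
Qed.

(** If [z] commutes with every [1 (x) b], then its coordinates are central in
    [B], so [z = a (x) 1]; if it also commutes with every [a' (x) 1], then [a]
    is central in [A]. *)
Lemma tensor_central : is_central A -> is_central B -> is_central (tensor A B).
Proof.
move=> /centralP cA /centralP cB; apply/centralP=> z cz.
have [c zE] : exists c : 'I_(\dim {:A}) -> F, forall i, z i = (c i)%:A.
  have /fin_all_exists//: forall i, exists c : F, z i = c%:A.
  move=> i; apply: cB => b; have := cz (1 \ox b).
  rewrite {1 2}[z]tensor_sum mulr_suml mulr_sumr => czb.
  have {czb}: \sum_(j < \dim {:A}) (e`_j \ox (z j * b)) =
      \sum_(j < \dim {:A}) (e`_j \ox (b * z j)).
    move: czb; under eq_bigr do rewrite pure_tensor_mul mulr1.
    by under [RHS]eq_bigr do rewrite pure_tensor_mul mul1r.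
  have sumE (y : tensor A B) : \sum_(j < \dim {:A}) e`_j \ox y j = y.
    by rewrite -tensor_sum.
  have := sumE [ffun j => z j * b]; under eq_bigr do rewrite ffunE.
  move=> ->; have := sumE [ffun j => b * z j]; under eq_bigr do rewrite ffunE.
  by move=> -> /ffunP/(_ i); rewrite !ffunE.
pose a := \sum_i c i *: e`_i.
have {zE}zE: z = a \ox 1.
  rewrite (tensor_sum z) pure_tensor_suml; apply: eq_bigr => i _.
  by rewrite zE pure_tensorZr pure_tensorZl.
have [d aE]: exists d : F, a = d%:A.
  apply: cA => a'; apply/eqP; rewrite -subr_eq0; apply/eqP/pure_tensor_inj1.
  have := cz (a' \ox 1); rewrite zE !pure_tensor_mul mulr1 => /eqP.
  rewrite -subr_eq0 -scaleN1r -pure_tensorZl -pure_tensorDl scaleN1r.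
  by move/eqP.
by exists d; rewrite zE aE pure_tensorZl.
Qed.

End TensorSimple.

(** * Matrix algebras and corners *)

(** ['M[A]_n.+1] with its structure of [F]-algebra, so that matrix algebras
    and [A] live in the same category. *)
Definition matalg (n : nat) (F : fieldType) (A : falgType F) : Type := 'M[A]_n.+1.

Section MatrixAlgebra.
Variables (n : nat) (F : fieldType) (A : falgType F).
Local Notation MA := (matalg n A).

HB.instance Definition _ := GRing.NzRing.copy MA 'M[A]_n.+1.

Definition matalg_scale (c : F) (M : MA) : MA := \matrix_(i, j) (c *: M i j).

Fact matalg_scaleA c d M :
  matalg_scale c (matalg_scale d M) = matalg_scale (c * d) M.
Proof. by apply/matrixP=> i j; rewrite !mxE scalerA. Qed.
Fact matalg_scale1 : left_id 1 matalg_scale.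
Proof. by move=> M; apply/matrixP=> i j; rewrite !mxE scale1r. Qed.
Fact matalg_scaleDr : right_distributive matalg_scale +%R.
Proof. by move=> c M N; apply/matrixP=> i j; rewrite !mxE scalerDr. Qed.
Fact matalg_scaleDl M : {morph matalg_scale^~ M : c d / c + d}.
Proof. by move=> c d; apply/matrixP=> i j; rewrite !mxE scalerDl. Qed.
HB.instance Definition _ := GRing.Zmodule_isLmodule.Build F MA
  matalg_scaleA matalg_scale1 matalg_scaleDr matalg_scaleDl.

Fact matalg_scalerAl (c : F) (M N : MA) : c *: (M * N) = c *: M * N.
Proof.
apply/matrixP=> i j; rewrite !mxE scaler_sumr; apply: eq_bigr => l _.
by rewrite mxE scalerAl.
Qed.
HB.instance Definition _ := GRing.Lmodule_isLalgebra.Build F MA matalg_scalerAl.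

Fact matalg_scalerAr (c : F) (M N : MA) : c *: (M * N) = M * (c *: N).
Proof.
apply/matrixP=> i j; rewrite !mxE scaler_sumr; apply: eq_bigr => l _.
by rewrite mxE scalerAr.
Qed.
HB.instance Definition _ := GRing.Lalgebra_isAlgebra.Build F MA matalg_scalerAr.

Fact matalg_vect_iso :
  SemiVector.axiom (dim {ffun 'I_n.+1 * 'I_n.+1 -> A}) MA.
Proof.
have [f [fZ fD] fB] :=
  VectorInternalTheory.v2r_subproof {ffun 'I_n.+1 * 'I_n.+1 -> A}.
pose h (M : MA) : {ffun 'I_n.+1 * 'I_n.+1 -> A} := [ffun p => M p.1 p.2].
have hZ c M : h (c *: M) = c *: h M by apply/ffunP=> p; rewrite !ffunE mxE.
have hD M N : h (M + N) = h M + h N.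
  by apply/ffunP=> p; rewrite !ffunE mxE.
have hB : bijective h.
  exists (fun g : {ffun 'I_n.+1 * 'I_n.+1 -> A} => \matrix_(i, j) g (i, j)) => [M|g].
    by apply/matrixP=> i j; rewrite !mxE ffunE.
  by apply/ffunP=> -[i j]; rewrite ffunE mxE.
apply: (@Build_semivector_axiom_def F _ MA (f \o h)); last exact: bij_comp.
by split=> [c M|M N]; rewrite /= ?hZ ?hD ?fZ ?fD.
Qed.
HB.instance Definition _ := LSemiModule_hasFinDim.Build F MA matalg_vect_iso.
HB.instance Definition _ := Algebra_isFalgebra.Build F MA.

Lemma matalgZE (c : F) (M : MA) i j : (c *: M) i j = c *: M i j.
Proof. exact: mxE. Qed.

Lemma matalg_scaleE (c : F) (M : MA) : c *: M = c%:A *: (M : 'M[A]_n.+1).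
Proof. by apply/matrixP=> i j; rewrite !mxE mulr_algl. Qed.

Lemma matalgM (M N : MA) i j : (M * N) i j = \sum_l M i l * N l j.
Proof. exact: mxE. Qed.

Lemma matalgD (M N : MA) i j : (M + N) i j = M i j + N i j.
Proof. exact: mxE. Qed.

Lemma matalg1 i j : (1 : MA) i j = (i == j)%:R.
Proof. by rewrite mxE. Qed.

Lemma dim_matalg : \dim {:MA} = (n.+1 * n.+1 * \dim {:A})%N.
Proof.
rewrite !dimvf -[LHS]/(#|{: 'I_n.+1 * 'I_n.+1}| * dim A)%N.
by rewrite card_prod !card_ord.
Qed.

Definition elem_mx i0 j0 (a : A) : MA :=
  \matrix_(i, j) (if (i == i0) && (j == j0) then a else 0).

Lemma elem_mxM i j l m a b :
  elem_mx i j a * elem_mx l m b = if j == l then elem_mx i m (a * b) else 0.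
Proof.
apply/matrixP=> p q; rewrite matalgM (bigD1 j) //= !mxE eqxx andbT big1 ?addr0.
  by case: (j == l); rewrite !mxE; do 2!case: eqP; rewrite ?(mul0r, mulr0).
by move=> r /negPf ne_rj; rewrite !mxE ne_rj andbF mul0r.
Qed.

Lemma elem_mx_sum (M : MA) : M = \sum_i \sum_j elem_mx i j (M i j).
Proof.
apply/matrixP=> p q; rewrite !summxE (bigD1 p) //= summxE (bigD1 q) //=.
rewrite mxE !eqxx big1 ?addr0 => [|j /negPf ne_jq].
  rewrite big1 ?addr0 // => i /negPf ne_ip.
  by rewrite summxE big1 // => j _; rewrite mxE eq_sym ne_ip.
by rewrite mxE (eq_sym q) ne_jq andbF.
Qed.

Lemma elem_mxD i j a b : elem_mx i j (a + b) = elem_mx i j a + elem_mx i j b.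
Proof. by apply/matrixP=> p q; rewrite !mxE; case: ifP; rewrite ?addr0. Qed.

Lemma elem_mxZ i j (c : F) a : elem_mx i j (c *: a) = c *: elem_mx i j a.
Proof. by apply/matrixP=> p q; rewrite !mxE; case: ifP; rewrite ?scaler0. Qed.

Lemma elem_mx_suml i j I r (P : pred I) (E : I -> A) :
  elem_mx i j (\sum_(l <- r | P l) E l) = \sum_(l <- r | P l) elem_mx i j (E l).
Proof.
apply: (big_morph (elem_mx i j)) => [a b|]; first exact: elem_mxD.
by rewrite -(scale0r 0) elem_mxZ scale0r.
Qed.

Lemma elem_mx_id i j a : elem_mx i j a i j = a.
Proof. by rewrite mxE !eqxx. Qed.

Lemma elem_mx_sandwich (M : MA) l i j m a b :
  elem_mx l i a * M * elem_mx j m b = elem_mx l m (a * M i j * b).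
Proof.
rewrite [in LHS](elem_mx_sum M) mulr_sumr mulr_suml (bigD1 i) //=.
rewrite mulr_sumr mulr_suml (bigD1 j) //= elem_mxM eqxx elem_mxM eqxx.
rewrite !big1 ?addr0 // => [p|q] /negPf ne.
  rewrite mulr_sumr mulr_suml big1 // => q _.
  by rewrite elem_mxM eq_sym ne mul0r.
by rewrite elem_mxM eqxx elem_mxM ne.
Qed.

(** If [x] is a nonzero entry of [M], in place [(i, j)], and [\sum a x b = 1],
    then [\sum (a E_li) M (b E_jl) = E_ll]; the sum over [l] is the identity. *)
Lemma matalg_simple : ring_simple A -> ring_simple MA.
Proof.
move=> sA M nz_M.
have [[i j] /= nz_a] : exists p, M p.1 p.2 != 0.
  apply/existsP; apply: contraR nz_M => /existsPn M0.
  apply/eqP/matrixP=> i j; rewrite mxE; apply/eqP/negbNE.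
  exact: M0 (i, j).
have [s s1] := sA _ nz_a.
exists [seq (elem_mx l i t.1, elem_mx j l t.2) | l <- enum 'I_n.+1, t <- s].
rewrite /sandwich big_allpairs_dep big_enum /=.
rewrite [RHS]elem_mx_sum; apply: eq_big => // l _.
rewrite [in RHS](bigD1 l) //= [X in _ + X]big1 ?addr0 => [|m /negPf ne_ml]; last first.
  rewrite matalg1 [l == m]eq_sym ne_ml.
  by apply/matrixP=> p q; rewrite !mxE if_same.
rewrite matalg1 eqxx -[1%:R]s1 elem_mx_suml; apply: eq_bigr => t _.
exact: elem_mx_sandwich.
Qed.

Lemma matalg_central : is_central A <-> is_central MA.
Proof.
split=> /centralP cA; apply/centralP=> z cz.
  have z0 i j : z i j = if i == j then z ord0 ord0 else 0.
    have := cz (elem_mx j ord0 1) => /matrixP/(_ i ord0).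
    rewrite !matalgM (bigD1 j) //= [RHS](bigD1 ord0) //= !mxE !eqxx /= mulr1.
    rewrite !big1 ?addr0 => [->|l /negPf ne_l|l /negPf ne_l].
    - by case: eqP; rewrite ?mul1r ?mul0r.
    - by rewrite !mxE ne_l andbF mul0r.
    - by rewrite !mxE ne_l mulr0.
  have [c zE] : exists c : F, z ord0 ord0 = c%:A.
    apply: cA => a; have := cz (elem_mx ord0 ord0 a) => /matrixP/(_ ord0 ord0).
    rewrite !matalgM (bigD1 ord0) //= [RHS](bigD1 ord0) //= !mxE !eqxx /=.
    rewrite !big1 ?addr0 // => l /negPf ne_l.
      by rewrite !mxE ne_l andbF mul0r.
    by rewrite !mxE ne_l mulr0.
  exists c; apply/matrixP=> i j; rewrite z0 matalgZE matalg1 zE.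
  by case: eqP; rewrite ?scaler0.
have diagM (a : A) (M : MA) i j : ((a%:M : MA) * M) i j = a * M i j.
  rewrite matalgM (bigD1 i) //= mxE eqxx mulr1n big1 ?addr0 // => l ne_l.
  by rewrite mxE eq_sym (negPf ne_l) mul0r.
have diagMr (a : A) (M : MA) i j : (M * (a%:M : MA)) i j = M i j * a.
  rewrite matalgM (bigD1 j) //= mxE eqxx mulr1n big1 ?addr0 // => l ne_l.
  by rewrite mxE (negPf ne_l) mulr0.
have /cA[c /matrixP/(_ ord0 ord0)] : forall M : MA, (z%:M : MA) * M = M * (z%:M : MA).
  by move=> M; apply/matrixP=> i j; rewrite diagM diagMr cz.
by rewrite matalgZE matalg1 mxE eqxx mulr1n => ->; exists c.
Qed.

End MatrixAlgebra.

(** A corner of [R] is a ring [e R e], [e] an idempotent.  A corner map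
    identifies [A] with the corner given by [e = f 1]; it is an isomorphism
    when [f 1 = 1]. *)
Record corner_map (F : fieldType) (A R : falgType F) (f : A -> R) : Prop := {
  corner_linear : linear f;
  cornerM : {morph f : x y / x * y};
  corner_inj : injective f;
  corner_img : forall x, f 1 * x * f 1 = x -> exists a, f a = x }.

Definition isomorphic (F : fieldType) (A B : falgType F) : Prop :=
  exists f : A -> B, corner_map f /\ f 1 = 1.

Section Corners.
Variables (F : fieldType) (A R : falgType F) (f : A -> R).
Hypothesis fC : corner_map f.

Definition corner_lin : {linear A -> R} :=
  HB.pack f (GRing.isLinear.Build F A R *:%R f (corner_linear fC)).

Lemma cornerZ c x : f (c *: x) = c *: f x. Proof. exact: (linearZZ corner_lin). Qed.
Lemma cornerD x y : f (x + y) = f x + f y. Proof. exact: (raddfD corner_lin). Qed.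
Lemma corner0 : f 0 = 0. Proof. exact: (raddf0 corner_lin). Qed.
Lemma corner_sum I r (P : pred I) E :
  f (\sum_(i <- r | P i) E i) = \sum_(i <- r | P i) f (E i).
Proof. exact: (raddf_sum corner_lin). Qed.

Lemma corner1l a : f 1 * f a = f a. Proof. by rewrite -(cornerM fC) mul1r. Qed.
Lemma corner1r a : f a * f 1 = f a. Proof. by rewrite -(cornerM fC) mulr1. Qed.

Lemma corner1_neq0 : f 1 != 0.
Proof. by rewrite -corner0 (inj_eq (corner_inj fC)) oner_neq0. Qed.

Lemma corner_inv : exists g : {linear R -> A},
  cancel f g /\ forall x, f 1 * x * f 1 = x -> f (g x) = x.
Proof.
have ker0: lker (linfun corner_lin) == 0%VS.
  by apply/lker0P=> x y; rewrite !lfunE => /(corner_inj fC).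
have fK a : (linfun corner_lin)^-1%VF (f a) = a.
  by rewrite -{2}[a](lker0_lfunK ker0) lfunE.
exists (linfun corner_lin)^-1%VF; split=> // x /(corner_img fC)[a <-].
by rewrite /= fK.
Qed.

End Corners.

Section Isomorphisms.
Variable F : fieldType.
Implicit Types A B R : falgType F.

Lemma corner_map_id A : corner_map (@id A).
Proof. by split=> // x _; exists x. Qed.

Lemma corner_map_comp A B R (f : A -> B) (g : B -> R) :
  corner_map f -> corner_map g -> corner_map (g \o f).
Proof.
move=> fC gC; split=> [c x y | x y | x y | x gx] /=.
- by rewrite (corner_linear fC) (corner_linear gC).
- by rewrite (cornerM fC) (cornerM gC).
- by move/(corner_inj gC)/(corner_inj fC).
have [b bx]: exists b, g b = x.
  apply: (corner_img gC); rewrite -gx /= !mulrA corner1l //.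
  by rewrite -!mulrA corner1r.
have [|a ab] := corner_img fC (x := b).
  by apply: (corner_inj gC); rewrite !(cornerM gC) bx.
by exists a; rewrite /= ab.
Qed.

Lemma iso_trans A B C : isomorphic A B -> isomorphic B C -> isomorphic A C.
Proof.
case=> f [fC f1] [g [gC g1]]; exists (g \o f).
by split; [apply: corner_map_comp | rewrite /= f1].
Qed.

Lemma iso_bij A B (f : A -> B) : corner_map f -> f 1 = 1 -> bijective f.
Proof.
move=> fC f1; have [g [fK gK]] := corner_inv fC.
by exists g => // x; rewrite gK // f1 mul1r mulr1.
Qed.

Lemma iso_of_bij A B (f : A -> B) : linear f -> {morph f : x y / x * y} ->
  f 1 = 1 -> bijective f -> isomorphic A B.
Proof.
move=> fL fM f1 [g fK gK]; exists f; split=> //; split=> //; first exact: can_inj fK.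
by move=> x _; exists (g x).
Qed.

Lemma iso_sym A B : isomorphic A B -> isomorphic B A.
Proof.
case=> f [fC f1]; have [g [fK gK]] := corner_inv fC.
have gK' x : f (g x) = x by rewrite gK // f1 mul1r mulr1.
apply: (iso_of_bij (f := g)); first exact: linearP.
- by move=> x y; apply: (corner_inj fC); rewrite (cornerM fC) !gK'.
- by apply: (corner_inj fC); rewrite gK' f1.
- by exists f.
Qed.

Lemma iso_central A B : isomorphic A B -> is_central A -> is_central B.
Proof.
move=> [f [fC f1]] /centralP cA; apply/centralP=> z cz.
have [g fK gK] := iso_bij fC f1.
have [a|c gz] := cA (g z).
  by apply: (corner_inj fC); rewrite !(cornerM fC) gK.
by exists c; rewrite -[z]gK gz (cornerZ fC) f1.
Qed.

Lemma corner_elem_mx n A : corner_map (@elem_mx n F A ord0 ord0).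
Proof.
split=> [c x y|x y|x y|M]; first by rewrite elem_mxD elem_mxZ.
- by rewrite elem_mxM eqxx.
- by move/matrixP/(_ ord0 ord0); rewrite !elem_mx_id.
move=> <-; exists (M ord0 ord0);
by rewrite elem_mx_sandwich mul1r mulr1.
Qed.

Lemma matrix_overP A D :
  matrix_over A D <-> exists n, isomorphic (matalg n D) A.
Proof.
split=> [[n [phi [phiB phiZ]]] | [n [f [fC f1]]]]; exists n.
  apply: (iso_of_bij (f := phi : matalg n D -> A)) => //.
  - by move=> c M N; rewrite rmorphD matalg_scaleE phiZ.
  - exact: rmorphM.
  - exact: rmorph1.
pose phi : {rmorphism 'M[D]_n.+1 -> A} :=
  HB.pack (f : 'M[D]_n.+1 -> A)
    (GRing.isZmodMorphism.Build 'M[D]_n.+1 A f (raddfB (corner_lin fC)))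
    (GRing.isMonoidMorphism.Build 'M[D]_n.+1 A f (conj f1 (cornerM fC))).
exists phi; split; first exact: iso_bij fC f1.
by move=> c M; rewrite -matalg_scaleE; exact: (cornerZ fC).
Qed.

Lemma brauer_equivP A B :
  brauer_equiv A B <-> exists m n, isomorphic (matalg m A) (matalg n B).
Proof.
split=> [[m [n [phi [phiB phiZ]]]] | [m [n [f [fC f1]]]]]; exists m, n.
  apply: (iso_of_bij (f := phi : matalg m A -> matalg n B)) => //.
  - by move=> c M N; rewrite rmorphD !matalg_scaleE phiZ.
  - exact: rmorphM.
  - exact: rmorph1.
pose phi : {rmorphism 'M[A]_m.+1 -> 'M[B]_n.+1} :=
  HB.pack (f : 'M[A]_m.+1 -> 'M[B]_n.+1)
    (GRing.isZmodMorphism.Build 'M[A]_m.+1 'M[B]_n.+1 f (raddfB (corner_lin fC)))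
    (GRing.isMonoidMorphism.Build 'M[A]_m.+1 'M[B]_n.+1 f (conj f1 (cornerM fC))).
exists phi; split; first exact: iso_bij fC f1.
by move=> c M; rewrite -!matalg_scaleE; exact: (cornerZ fC).
Qed.

End Isomorphisms.

(** * Matrix units and the theorems of Wedderburn *)

(** Simple rings are prime. *)
Lemma simple_connect (R : nzRingType) (x y : R) :
  ring_simple R -> x != 0 -> y != 0 -> exists a, x * a * y != 0.
Proof.
move=> sR nz_x /sR[s s1].
have [/hasP[t _ nz] | /hasPn all0] := boolP (has (fun t => x * t.1 * y != 0) s).
  by exists t.1.
case/eqP: nz_x; rewrite -[x]mulr1 -s1 mulr_sumr big_seq big1 // => t /all0.
by move/negbNE/eqP=> xty; rewrite !mulrA xty mul0r.
Qed.

Section Morita.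
Variables (F : fieldType) (R E : falgType F) (q : E -> R).
Hypotheses (sR : ring_simple R) (divE : is_division E) (qC : corner_map q).
Local Notation e := (q 1).

(** Primeness gives a nonzero [e b (f a e)] in the division corner [e R e]; its
    inverse turns [e b f] and [f a e] into the required pair. *)
Lemma corner_connect f : f * f = f -> f != 0 ->
  exists u v, [/\ u * v = e, e * u = u, u * f = u, f * v = v & v * e = v].
Proof.
move=> ff nz_f; have ee: e * e = e by rewrite (corner1l qC).
have nz_e := corner1_neq0 qC.
have [a nz_x] := simple_connect sR nz_f nz_e.
have [b nz_y] := simple_connect sR nz_e nz_x.
have [d dE]: exists d, q d = e * b * (f * a * e).
  by apply: (corner_img qC); rewrite !mulrA ee -!mulrA ee.
have Ud: d \is a GRing.unit.
  by apply: divE; apply: contraNneq nz_y => d0; rewrite -dE d0 (corner0 qC).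
exists (e * b * f), (f * a * e * q d^-1); split.
- transitivity (q d * q d^-1); last by rewrite -(cornerM qC) divrr.
  by rewrite dE !mulrA -[_ * f * f]mulrA ff.
- by rewrite !mulrA ee.
- by rewrite -mulrA ff.
- by rewrite !mulrA ff.
- by rewrite -mulrA (corner1r qC).
Qed.

(** The [u i] and [v i] witness an isomorphism [f R ~ (e R)^n] of right ideals.
    They are split off from [f] one pair at a time: [v u] is an idempotent below
    [f], so [f - v u] generates a smaller right ideal. *)
Lemma matrix_units f : f * f = f ->
  exists n (u v : nat -> R),
  [/\ forall i j, (i < n)%N -> (j < n)%N -> u i * v j = if i == j then e else 0,
      forall i, (i < n)%N ->
        [/\ e * u i = u i, u i * f = u i, f * v i = v i & v i * e = v i]
    & \sum_(i < n) v i * u i = f].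
Proof.
have [d] := ubnP (\dim (limg (amull f))); elim: d f => // d IHd f led ff.
have [-> | nz_f] := eqVneq f 0.
  by exists 0, (fun=> 0), (fun=> 0); split; rewrite ?big_ord0.
have [u [v [uv eu uf fv ve]]] := corner_connect ff nz_f.
pose f' := f - v * u.
have f'v: f' * v = 0 by rewrite mulrBl -mulrA uv ve fv subrr.
have uf': u * f' = 0 by rewrite mulrBr mulrA uv eu uf subrr.
have ff': f * f' = f' by rewrite mulrBr ff mulrA fv.
have f'f: f' * f = f' by rewrite mulrBl ff -mulrA uf.
have f'f': f' * f' = f' by rewrite {1}/f' mulrBl ff' -mulrA uf' mulr0 subr0.
have ltf': (\dim (limg (amull f')) < d)%N.
  rewrite ltnS in led; apply: leq_trans led.
  have sf'f: (limg (amull f') <= limg (amull f))%VS.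
    apply/subvP=> _ /memv_imgP[a _ ->]; rewrite lfunE /= -ff' -mulrA.
    by apply/memv_imgP; exists (f' * a); rewrite ?memvf // lfunE.
  rewrite (ltn_leqif (dimv_leqif_eq sf'f)).
  apply: contraNneq (corner1_neq0 qC) => eq_f'.
  have: v \in limg (amull f').
    by rewrite eq_f'; apply/memv_imgP; exists v; rewrite ?memvf // lfunE.
  case/memv_imgP=> a _; rewrite lfunE /= => va.
  by rewrite -uv va -f'f' -[f' * f' * a]mulrA -va f'v mulr0.
have [n [u' [v' [u'v' ev' sum']]]] := IHd f' ltf' f'f'.
have uu i : (i < n)%N -> u' i * v = 0.
  by case/ev'=> _ <- _ _; rewrite -mulrA f'v mulr0.
have vv i : (i < n)%N -> u * v' i = 0.
  by case/ev'=> _ _ <- _; rewrite mulrA uf' mul0r.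
exists n.+1, (fun i => if (i < n)%N then u' i else u).
exists (fun i => if (i < n)%N then v' i else v); split=> [i j|i|].
- rewrite !ltnS; case: (ltnP i n) => [lti|lein] lei; case: (ltnP j n) => [ltj|lejn] lej.
  + exact: u'v'.
  + by rewrite uu // ltn_eqF // (leq_trans lti).
  + by rewrite vv // gtn_eqF // (leq_trans ltj).
  + by rewrite uv (eqP (_ : i == j)) ?eqxx // eqn_leq (leq_trans lei) ?(leq_trans lej).
- rewrite ltnS; case: (ltnP i n) => // /ev'[eu' u'f' f'v' ve'] _; split=> //.
    by rewrite -u'f' -mulrA f'f.
  by rewrite -f'v' mulrA ff'.
rewrite big_ord_recr /= ltnn.
under eq_bigr do rewrite ltn_ord.
by rewrite sum' subrK.
Qed.

(** Two corners of a simple ring are Morita equivalent, so the corner [A] is a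
    matrix algebra over the corner [E].  This covers at once the existence
    part of Wedderburn's theorem (with [A = R]) and the comparison of Brauer
    equivalent algebras, which are corners of a common matrix algebra. *)
Lemma corner_matrix (A : falgType F) (p : A -> R) :
  corner_map p -> exists n, isomorphic (matalg n E) A.
Proof.
move=> pC; have pp: p 1 * p 1 = p 1 by rewrite (corner1l pC).
have [[|n] [u [v [uv pe sum_vu]]]] := matrix_units pp.
  by have := corner1_neq0 pC; rewrite -sum_vu big_ord0 eqxx.
have [h [_ hK]] := corner_inv qC.
pose psi (x : A) : matalg n E := \matrix_(i, j) h (u i * p x * v j).
have psiE x i j : q (psi x i j) = u i * p x * v j.
  rewrite mxE hK // !mulrA; have [-> _ _ _] := pe i (ltn_ord i).
  by have [_ _ _ ve] := pe j (ltn_ord j); rewrite -!mulrA ve.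
have pE x : p x = \sum_(i < n.+1) \sum_(j < n.+1) v i * (u i * p x * v j) * u j.
  rewrite -{1}(corner1l pC x) -{1}(corner1r pC x) -sum_vu mulr_suml.
  apply: eq_bigr => i _; rewrite !mulr_sumr; apply: eq_bigr => j _.
  by rewrite !mulrA.
exists n; apply: iso_sym; exists psi; split.
  split=> [c x y|x y|x y eq_xy|M _].
  - apply/matrixP=> i j; rewrite matalgD matalgZE !mxE -linearP (corner_linear pC).
    by rewrite mulrDr mulrDl -scalerAr -scalerAl.
  - apply/matrixP=> i j; apply: (corner_inj qC).
    rewrite matalgM (corner_sum qC) psiE (cornerM pC) -{1}(corner1r pC x) -sum_vu.
    rewrite mulr_sumr !mulr_suml mulr_sumr mulr_suml; apply: eq_bigr => l _.
    by rewrite (cornerM qC) !psiE !mulrA.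
  - apply: (corner_inj pC); rewrite pE [RHS]pE.
    by apply: eq_bigr => i _; apply: eq_bigr => j _; rewrite -!psiE eq_xy.
  pose S := \sum_(i < n.+1) \sum_(j < n.+1) v i * q (M i j) * u j.
  have [|x pxS] := corner_img pC (x := S).
    rewrite mulr_sumr mulr_suml; apply: eq_bigr => i _.
    rewrite mulr_sumr mulr_suml; apply: eq_bigr => j _.
    have [_ _ pv _] := pe i (ltn_ord i); have [_ up _ _] := pe j (ltn_ord j).
    by rewrite !mulrA pv -!mulrA up.
  exists x; apply/matrixP=> i j; apply: (corner_inj qC); rewrite psiE pxS.
  rewrite mulr_sumr mulr_suml (bigD1 i) //= mulr_sumr mulr_suml (bigD1 j) //=.
  rewrite !mulrA uv ?ltn_ord // eqxx (corner1l qC) -mulrA uv ?ltn_ord // eqxx.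
  rewrite (corner1r qC) !big1 ?addr0 // => [l|l] ne_l.
    rewrite mulr_sumr mulr_suml big1 // => m _.
    by rewrite !mulrA uv ?ltn_ord // eq_sym (inj_eq val_inj) (negPf ne_l) !mul0r.
  by rewrite -!mulrA uv ?ltn_ord // (inj_eq val_inj) (negPf ne_l) !mulr0.
apply/matrixP=> i j; apply: (corner_inj qC); rewrite psiE matalg1.
have [_ -> _ _] := pe i (ltn_ord i); rewrite uv ?ltn_ord // (inj_eq val_inj).
by case: eqP; rewrite ?(corner0 qC).
Qed.

End Morita.

Section Wedderburn.
Variables (F : fieldType) (R : falgType F).
Hypothesis sR : ring_simple R.
Local Notation "x '*R'" := (limg (amull x)) (at level 30).

Lemma mem_rideal (x a : R) : x * a \in x *R.
Proof. by apply/memv_imgP; exists a; rewrite ?memvf ?lfunE. Qed.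

Lemma ridealP (x y : R) : y \in x *R -> exists a, y = x * a.
Proof. by case/memv_imgP=> a _; rewrite lfunE; exists a. Qed.

Lemma min_rideal : exists2 x : R, x != 0 &
  forall y : R, y != 0 -> y \in x *R -> exists a, x = y * a.
Proof.
suffices [x nz_x minx] : exists2 x : R, x != 0 &
    forall y : R, y != 0 -> (\dim (x *R) <= \dim (y *R))%N.
  exists x => // y nz_y /ridealP[a yxa]; apply: ridealP.
  suffices /eqP-> : y *R == x *R by rewrite -{1}[x]mulr1 mem_rideal.
  rewrite eqEdim minx // andbT; apply/subvP=> _ /ridealP[b ->].
  by rewrite yxa -mulrA mem_rideal.
have [d] := ubnP (\dim ((1 : R) *R)); have := oner_neq0 R.
elim: d (1 : R) => // d IHd x nz_x led.
(* no algorithm decides whether a smaller right ideal exists *)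
have [[y [nz_y lt_y]] | no_y] :=
  classic (exists y : R, y != 0 /\ (\dim (y *R) < \dim (x *R))%N).
  by apply: (IHd y nz_y); apply: leq_trans lt_y _.
exists x => // y nz_y; rewrite leqNgt; apply/negP=> lt_y.
by case: no_y; exists y.
Qed.

(** A minimal right ideal [x R] of a simple ring is generated by an idempotent:
    if [z] in [x R] has [z x != 0], then [z] acts injectively on [x R], hence
    [z e = z] for some [e] in [x R] and [e] is idempotent. *)
Lemma primitive_idempotent : exists e : R,
  [/\ e != 0, e * e = e & forall y : R, y != 0 -> e * y = y -> exists a, y * a = e].
Proof.
have [x nz_x minx] := min_rideal.
have [a nz_zx] := simple_connect sR nz_x nz_x; set z := x * a in nz_zx.
have [c xE]: exists c, x = z * x * c.
  by apply: minx; rewrite // /z -!mulrA mem_rideal.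
pose e := x * (c * a).
have ze: z * e = z by rewrite /e !mulrA -xE.
have nz_z: z != 0 by apply: contraNneq nz_zx => ->; rewrite mul0r.
have nz_e: e != 0 by apply: contraNneq nz_z => e0; rewrite -ze e0 mulr0.
have ee: e * e = e.
  apply/eqP; rewrite -subr_eq0; apply: contraNT nz_zx => nz_w.
  have [|b ->] := minx _ nz_w.
    by rewrite /e -mulrA -mulrBr mem_rideal.
  by rewrite mulrA mulrBr mulrA !ze subrr mul0r.
have [b xe]: exists b, x = e * b by apply: minx; rewrite // mem_rideal.
exists e; split=> // y nz_y ey.
have [|d xy] := minx y nz_y; first by rewrite -ey /e -mulrA mem_rideal.
by exists (d * (c * a)); rewrite mulrA -xy.
Qed.

Lemma division_corner : exists (E : falgType F) (q : E -> R),
  is_division E /\ corner_map q.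
Proof.
have [e [nz_e ee dive]] := primitive_idempotent.
pose U := limg (amull e \o amulr e)%VF.
have memU a : (a \in U) = (e * a * e == a).
  apply/memv_imgP/eqP => [[b _ ->] | <-].
    by rewrite lfunE /= !lfunE /= !mulrA ee -!mulrA ee.
  by exists a; rewrite ?memvf // lfunE /= !lfunE /= mulrA.
have Ue: e \in U by rewrite memU !ee.
have U_algebra : is_aspace U.
  apply/andP; split.
    apply/has_algidP; exists e; split=> // a; rewrite memU => /eqP <-.
    by rewrite -!mulrA ee !mulrA ee.
  apply/prodvP=> a b; rewrite !memU => /eqP <- /eqP <-.
  by rewrite !mulrA ee -!mulrA ee.
pose E := subvs_of (ASpace U_algebra); exists E, vsval.
have val1: vsval (1 : E) = e.
  have := memv_algid (ASpace U_algebra); rewrite /= memU => /eqP aE.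
  rewrite -[LHS]/(algid (ASpace U_algebra)) -aE.
  by rewrite [e * _](algidr (A := ASpace U_algebra)).
split; last first.
  split=> [c x y|x y|x y|x] //; first exact: val_inj.
  rewrite val1 => /eqP; rewrite -memU => Ux.
  by exists (Subvs Ux).
have rinv (x : E) : x != 0 -> exists y, x * y = 1.
  move=> nz_x; have Ux: e * vsval x * e == vsval x by rewrite -memU subvsP.
  have [||a xa] := dive (vsval x).
    by apply: contra nz_x => /eqP x0; apply/eqP/val_inj.
    by rewrite -(eqP Ux) !mulrA ee.
  have Ua: e * a * e \in U by rewrite memU !mulrA ee -!mulrA ee.
  exists (Subvs Ua); apply: val_inj.
  rewrite -[RHS]/(vsval (1 : E)) val1 -[LHS]/(vsval x * (e * a * e)).
  rewrite !mulrA -{1}(eqP Ux) -![_ * e * e]mulrA ee.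
  by rewrite (eqP Ux) xa.
apply: domain_division => x y xy0; have [|/rinv[z yz]] := eqVneq y 0; first by right.
by left; rewrite -[x]mulr1 -yz mulrA xy0 mul0r.
Qed.

Lemma wedderburn : exists n (E : falgType F),
  is_division E /\ isomorphic (matalg n E) R.
Proof.
have [E [q [divE qC]]] := division_corner.
have [n isoR] := corner_matrix sR divE qC (corner_map_id R).
by exists n, E.
Qed.

End Wedderburn.

(** * Forms of algebras *)

(** [j : B -> A] exhibits [A] as the algebra [B (x)_k F], for the field
    embedding [s : k -> F].  No basis is mentioned: spanning is an induction
    principle, and linear independence is the equality of dimensions. *)
Record is_form (k F : fieldType) (s : k -> F) (B : falgType k) (A : falgType F)
    (j : B -> A) : Prop := {
  form_morphD : {morph j : x y / x + y};
  form_morphZ : forall c b, j (c *: b) = s c *: j b;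
  form_morphM : {morph j : x y / x * y};
  form_morph1 : j 1 = 1;
  form_span : forall P : A -> Prop,
    P 0 -> (forall x y, P x -> P y -> P (x + y)) ->
    (forall c b, P (c *: j b)) -> forall a, P a;
  form_dim : \dim {:A} = \dim {:B} }.

Definition has_form (k F : fieldType) (s : k -> F) (B : falgType k)
  (A : falgType F) : Prop := exists j : B -> A, is_form s j.

Lemma iso_dim (F : fieldType) (A B : falgType F) :
  isomorphic A B -> \dim {:A} = \dim {:B}.
Proof.
case=> f [fC f1]; pose fL := linfun (corner_lin fC).
have ker0: lker fL == 0%VS.
  by apply/lker0P=> x y; rewrite !lfunE => /(corner_inj fC).
have imf: limg fL = {:B}%VS.
  apply/eqP; rewrite eqEsubv subvf; apply/subvP=> y _.
  have [|x <-] := corner_img fC (x := y); first by rewrite f1 mul1r mulr1.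
  by apply/memv_imgP; exists x; rewrite ?memvf // lfunE.
by rewrite -imf limg_dim_eq // (eqP ker0) capv0.
Qed.

Section FormBasis.
Variables (k F : fieldType) (s : {rmorphism k -> F}).
Variables (B : falgType k) (A : falgType F) (j : B -> A).
Hypothesis jF : is_form s j.
Local Notation n := (\dim {:B}).
Local Notation e := (vbasis {:B}).

Lemma form0 : j 0 = 0.
Proof. by apply: (addrI (j 0)); rewrite -(form_morphD jF) !addr0. Qed.

Lemma form_sum I r (P : pred I) E :
  j (\sum_(i <- r | P i) E i) = \sum_(i <- r | P i) j (E i).
Proof. exact: (big_morph j (form_morphD jF) form0). Qed.

Definition form_basis : n.-tuple A := [tuple j e`_i | i < n].

Lemma nth_form_basis (i : 'I_n) : form_basis`_i = j e`_i.
Proof. by rewrite -tnth_nth tnth_mktuple. Qed.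

Lemma formE b : j b = \sum_(i < n) s (coord e i b) *: form_basis`_i.
Proof.
rewrite {1}(coord_vbasis (memvf b)) form_sum.
by apply: eq_bigr => i _; rewrite (form_morphZ jF) nth_form_basis.
Qed.

Lemma form_basisP : basis_of {:A} form_basis.
Proof.
rewrite basisEdim size_tuple (form_dim jF) leqnn andbT.
apply/subvP=> a _; apply: (form_span jF (P := fun a => a \in _)) a => [|x y|c b].
- exact: mem0v.
- exact: memvD.
rewrite memvZ // formE memv_suml // => i _; rewrite memvZ // memv_span //.
by rewrite mem_nth ?size_tuple.
Qed.

Definition form_coord i : A -> F := coord form_basis i.

Lemma form_coordD i x y : form_coord i (x + y) = form_coord i x + form_coord i y.
Proof. exact: raddfD. Qed.

Lemma form_coordZ i c x : form_coord i (c *: x) = c * form_coord i x.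
Proof. exact: linearZ. Qed.

Lemma form_expand x : x = \sum_(i < n) form_coord i x *: j e`_i.
Proof.
rewrite {1}(coord_basis form_basisP (memvf x)).
by apply: eq_bigr => i _; rewrite nth_form_basis.
Qed.

Lemma form_coord_sum (c : 'I_n -> F) i :
  form_coord i (\sum_(l < n) c l *: j e`_l) = c i.
Proof.
under eq_bigr do rewrite -nth_form_basis.
exact: coord_sum_free (basis_free form_basisP).
Qed.

Lemma form_coordE i b : form_coord i (j b) = s (coord e i b).
Proof.
by rewrite formE; apply: coord_sum_free (basis_free form_basisP).
Qed.

Lemma form_coord_inj x y : (forall i, form_coord i x = form_coord i y) -> x = y.
Proof.
move=> eq_xy; rewrite [x]form_expand [y]form_expand.
by apply: eq_bigr => i _; rewrite eq_xy.
Qed.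

Lemma form_inj : injective j.
Proof.
move=> b b' eq_j; rewrite (coord_vbasis (memvf b)) (coord_vbasis (memvf b')).
apply: eq_bigr => i _; congr (_ *: _).
by apply: (fmorph_inj s); rewrite -!form_coordE eq_j.
Qed.

Lemma form_division : is_division A -> is_division B.
Proof.
move=> divA; apply: domain_division => x y /(congr1 j).
rewrite (form_morphM jF) form0 => /(division_domain divA)[] j0; [left | right];
  by apply: form_inj; rewrite j0 form0.
Qed.

(** The multiplication map of [B] that sends the [i]-th basis vector to [1] and
    the other ones to [0] acts on [A] as well; it sends a central [z] with
    [i]-th coordinate [z_i] to [z_i], and also to a scalar multiple of [z]. *)
Lemma form_central : is_central B -> ring_simple B -> is_central A.
Proof.
move=> cB sB; apply/centralP => z cz.
have [i nz_i] : exists i, coord e i (1 : B) != 0.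
  apply/existsP; apply: contraR (oner_neq0 B) => /existsPn all0.
  rewrite (coord_vbasis (memvf 1)) big1 // => i _.
  by rewrite (eqP (negbNE (all0 i))) scale0r.
have [t [t1 t0]] := isolate_vbasis cB sB i.
pose t' := [seq (j p.1, j p.2) | p <- t].
have tj b : sandwich t' (j b) = j (sandwich t b).
  rewrite /sandwich big_map form_sum; apply: eq_bigr => p _.
  by rewrite !(form_morphM jF).
have tz : sandwich t' z = (form_coord i z)%:A.
  rewrite {1}(form_expand z) raddf_sum (bigD1 i) //= big1 => [|l ne_l].
    by rewrite sandwichZ tj t1 (form_morph1 jF) addr0.
  by rewrite sandwichZ tj t0 // form0 scaler0.
have t1E : sandwich t 1 = (coord e i 1)%:A.
  rewrite {1}(coord_vbasis (memvf 1)) raddf_sum (bigD1 i) //= big1 => [|l ne_l].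
    by rewrite sandwichZ t1 addr0.
  by rewrite sandwichZ t0 // scaler0.
have tz' : sandwich t' z = s (coord e i 1) *: z.
  transitivity (z * sandwich t' 1).
    rewrite /sandwich mulr_sumr; apply: eq_bigr => p _.
    by rewrite -cz mulr1 mulrA.
  by rewrite -(form_morph1 jF) tj t1E (form_morphZ jF) (form_morph1 jF) mulr_algr.
exists ((s (coord e i 1))^-1 * form_coord i z).
rewrite -scalerA -tz tz' scalerA mulVf ?scale1r //.
by rewrite fmorph_eq0.
Qed.

End FormBasis.

Section FormTransport.
Variables (k F : fieldType) (s : {rmorphism k -> F}).
Implicit Types (B : falgType k) (A : falgType F).

Lemma form_unique B A A' : has_form s B A -> has_form s B A' -> isomorphic A A'.
Proof.
move=> [j jF] [j' jF'].
pose f x := \sum_(i < \dim {:B}) form_coord j i x *: j' (vbasis {:B})`_i.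
have fL c x y : f (c *: x + y) = c *: f x + f y.
  rewrite /f scaler_sumr -big_split; apply: eq_bigr => i _ /=.
  by rewrite form_coordD form_coordZ scalerDl scalerA.
have fj b : f (j b) = j' b.
  rewrite (formE jF') /f; apply: eq_bigr => i _.
  by rewrite (form_coordE jF) nth_form_basis.
have f0: f 0 = 0 by rewrite -(form0 jF) fj (form0 jF').
have fZ c x : f (c *: x) = c *: f x by rewrite -[c *: x]addr0 fL f0 addr0.
have fD x y : f (x + y) = f x + f y by rewrite -[x]scale1r fL !scale1r.
exists f; split; last by rewrite -(form_morph1 jF) fj (form_morph1 jF').
split=> // [x y|x y eq_f|y _].
- apply: (form_span jF (P := fun x => f (x * y) = f x * f y)) x.
  + by rewrite !(mul0r, f0).
  + by move=> x x' fx fx'; rewrite mulrDl !fD fx fx' mulrDl.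
  move=> c b; apply: (form_span jF (P := fun y => f (_ * y) = _ * f y)) y.
  + by rewrite !(mulr0, f0).
  + by move=> x x' fx fx'; rewrite mulrDr !fD fx fx' mulrDr.
  move=> d b'; rewrite -scalerAl -scalerAr -(form_morphM jF) !fZ !fj (form_morphM jF').
  by rewrite -scalerAl -scalerAr.
- apply: (form_coord_inj jF) => i.
  by move/(congr1 (form_coord j' i)): eq_f; rewrite !(form_coord_sum jF').
exists (\sum_(i < \dim {:B}) form_coord j' i y *: j (vbasis {:B})`_i).
rewrite [RHS](form_expand jF') /f.
by apply: eq_bigr => i _; rewrite (form_coord_sum jF).
Qed.

Lemma form_isol B B' A : isomorphic B' B -> has_form s B A -> has_form s B' A.
Proof.
move=> isoB [j jF]; have dimB := iso_dim isoB; case: isoB => f [fC f1].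
exists (j \o f); split=> /= [x y|c x|x y||P P0 PD Pj|].
- by rewrite /= (cornerD fC) (form_morphD jF).
- by rewrite (cornerZ fC) (form_morphZ jF).
- by rewrite /= (cornerM fC) (form_morphM jF).
- by rewrite f1 (form_morph1 jF).
- apply: (form_span jF) => // c b; have [|b' <-] := corner_img fC (x := b) => //.
  by rewrite f1 mul1r mulr1.
- by rewrite dimB; apply: form_dim jF.
Qed.

Lemma form_isor B A A' : isomorphic A A' -> has_form s B A -> has_form s B A'.
Proof.
move=> isoA [j jF]; have dimA := iso_dim isoA; case: isoA => f [fC f1].
exists (f \o j); split=> /= [x y|c x|x y||P P0 PD Pj a|].
- by rewrite /= (form_morphD jF) (cornerD fC).
- by rewrite (form_morphZ jF) (cornerZ fC).
- by rewrite /= (form_morphM jF) (cornerM fC).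
- by rewrite (form_morph1 jF).
- have [|a' <-] := corner_img fC (x := a); first by rewrite f1 mul1r mulr1.
  apply: (form_span jF (P := P \o f)) a' => /= [|x y Px Py|c b].
  + by rewrite (corner0 fC).
  + by rewrite (cornerD fC); apply: PD.
  by rewrite (cornerZ fC).
- by rewrite -dimA; apply: form_dim jF.
Qed.

Lemma form_regular : has_form s k^o F^o.
Proof.
exists s; split=> [x y|c x|x y||P P0 PD Ps a|].
- exact: rmorphD.
- exact: rmorphM.
- exact: rmorphM.
- exact: rmorph1.
- by have := Ps a 1; rewrite rmorph1 [a *: 1]mulr1.
- by rewrite !dimvf.
Qed.

Lemma form_matalg n B A : has_form s B A -> has_form s (matalg n B) (matalg n A).
Proof.
move=> [j jF]; pose J (M : matalg n B) : matalg n A := \matrix_(a, b) j (M a b).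
exists J; split=> [x y|c x|x y||P P0 PD Pj a|].
- by apply/matrixP=> a b; rewrite !mxE (form_morphD jF).
- by apply/matrixP=> a b; rewrite !mxE (form_morphZ jF).
- apply/matrixP=> a b; rewrite matalgM !mxE (form_sum jF).
  by apply: eq_bigr => l _; rewrite !mxE (form_morphM jF).
- apply/matrixP=> a b; rewrite mxE !matalg1.
  by case: eqP; rewrite ?(form_morph1 jF) ?(form0 jF).
- rewrite [a]elem_mx_sum; apply: (big_ind P) => // p _; apply: (big_ind P) => // q _.
  apply: (form_span jF (P := fun b => P (elem_mx p q b))) (a p q).
  + by have := Pj 0 0; rewrite scale0r -(scale0r (0 : A)) elem_mxZ scale0r.
  + by move=> x y Px Py; rewrite elem_mxD; apply: PD.
  move=> c b; suffices -> : elem_mx p q (c *: j b) = c *: J (elem_mx p q b) by [].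
  rewrite elem_mxZ; congr (_ *: _); apply/matrixP=> u v; rewrite !mxE.
  by case: ifP; rewrite ?(form0 jF).
by rewrite !dim_matalg (form_dim jF).
Qed.

Lemma form_opp B A : has_form s B A -> has_form s B^c A^c.
Proof.
move=> [j jF]; exists (j : B^c -> A^c); split.
- exact: form_morphD jF.
- exact: form_morphZ jF.
- by move=> x y; apply: (form_morphM jF).
- exact: form_morph1 jF.
- exact: form_span jF.
by have := form_dim jF; rewrite !dimvf.
Qed.

End FormTransport.

(** [B (x)_k F], an element being written uniquely as [\sum_i x_i e_i] with
    [e_i] the [i]-th element of [vbasis {:B}] and [x_i : F].  The extension
    [F / k] may be infinite, so this is not a case of [tensor]. *)
Definition ext (k F : fieldType) (s : {rmorphism k -> F}) (B : falgType k) : Type :=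
  {ffun 'I_(\dim {:B}) -> F^o}.

Section ScalarExtension.
Variables (k F : fieldType) (s : {rmorphism k -> F}) (B : falgType k).
Local Notation E := (ext s B).
Local Notation n := (\dim {:B}).
Local Notation e := (vbasis {:B}).

HB.instance Definition _ := Vector.copy E {ffun 'I_n -> F^o}.

Definition ext_in (b : B) : E := [ffun i => s (coord e i b)].
Definition ext_mul (x y : E) : E :=
  \sum_(i < n) \sum_(l < n) (x i * y l) *: ext_in (e`_i * e`_l).

Lemma ext_inD b b' : ext_in (b + b') = ext_in b + ext_in b'.
Proof. by apply/ffunP=> i; rewrite !ffunE raddfD rmorphD. Qed.
Lemma ext_inZ c b : ext_in (c *: b) = s c *: ext_in b.
Proof. by apply/ffunP=> i; rewrite !ffunE linearZ rmorphM. Qed.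
Lemma ext_in0 : ext_in 0 = 0.
Proof. by apply/ffunP=> i; rewrite !ffunE raddf0 rmorph0. Qed.

Lemma ext_sum (x : E) : x = \sum_(i < n) x i *: ext_in e`_i.
Proof.
apply/ffunP=> l; rewrite sum_ffunE (bigD1 l) //= big1 ?addr0 => [|i /negPf ne_il].
  by rewrite !ffunE coord_free ?(basis_free (vbasisP _)) // eqxx rmorph1 [RHS]mulr1.
by rewrite !ffunE coord_free ?(basis_free (vbasisP _)) // ne_il rmorph0 [LHS]mulr0.
Qed.

Lemma ext_mulDl : left_distributive ext_mul +%R.
Proof.
move=> x y z; rewrite -big_split; apply: eq_bigr => i _.
rewrite -big_split; apply: eq_bigr => l _.
by rewrite ffunE mulrDl scalerDl.
Qed.

Lemma ext_mulDr : right_distributive ext_mul +%R.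
Proof.
move=> x y z; rewrite -big_split; apply: eq_bigr => i _.
rewrite -big_split; apply: eq_bigr => l _.
by rewrite ffunE mulrDr scalerDl.
Qed.

Lemma ext_mulZl (c : F) x y : ext_mul (c *: x) y = c *: ext_mul x y.
Proof.
rewrite scaler_sumr; apply: eq_bigr => i _; rewrite scaler_sumr.
by apply: eq_bigr => l _; rewrite ffunE scalerA mulrA.
Qed.

Lemma ext_mulZr (c : F) x y : ext_mul x (c *: y) = c *: ext_mul x y.
Proof.
rewrite scaler_sumr; apply: eq_bigr => i _; rewrite scaler_sumr.
by apply: eq_bigr => l _; rewrite ffunE scalerA mulrCA.
Qed.

Lemma ext_inM b b' : ext_mul (ext_in b) (ext_in b') = ext_in (b * b').
Proof.
rewrite {2}(coord_vbasis (memvf b)) {2}(coord_vbasis (memvf b')) mulr_suml.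
rewrite (big_morph _ ext_inD ext_in0); apply: eq_bigr => i _.
rewrite mulr_sumr (big_morph _ ext_inD ext_in0); apply: eq_bigr => l _.
by rewrite -scalerAl -scalerAr scalerA ext_inZ rmorphM !ffunE.
Qed.

Lemma ext_mul_suml I (r : seq I) P (x : I -> E) y :
  ext_mul (\sum_(i <- r | P i) x i) y = \sum_(i <- r | P i) ext_mul (x i) y.
Proof.
apply: (big_morph (ext_mul^~ y)) => [x' z|]; first exact: ext_mulDl.
by rewrite -[X in ext_mul X](scale0r (0 : E)) ext_mulZl scale0r.
Qed.

Lemma ext_mul_sumr I (r : seq I) P (x : I -> E) y :
  ext_mul y (\sum_(i <- r | P i) x i) = \sum_(i <- r | P i) ext_mul y (x i).
Proof.
apply: (big_morph (ext_mul y)) => [x' z|]; first exact: ext_mulDr.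
by rewrite -[X in ext_mul _ X](scale0r (0 : E)) ext_mulZr scale0r.
Qed.

Fact ext_mulA : associative ext_mul.
Proof.
have sumE u : exists U, u = \sum_(i < n) U i *: ext_in e`_i.
  by exists u; apply: ext_sum.
move: ext_mul_suml ext_mul_sumr ext_inM ext_mulZl ext_mulZr.
move: ext_mul => m suml sumr mE mZl mZr.
move=> x y z; have [X ->] := sumE x; rewrite !suml; apply: eq_bigr => i _.
have [Y ->] := sumE y; rewrite suml !sumr suml; apply: eq_bigr => j _.
have [Z ->] := sumE z; rewrite !sumr; apply: eq_bigr => l _.
rewrite !(mZl, mZr, mE) !scalerA !mulrA; congr (_ *: _).
by rewrite -[RHS]mulrA [RHS]mulrC.
Qed.

Fact ext_mul1l : left_id (ext_in 1) ext_mul.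
Proof.
move=> x; rewrite {1}(ext_sum x) ext_mul_sumr [RHS]ext_sum; apply: eq_bigr => i _.
by rewrite ext_mulZr ext_inM mul1r.
Qed.

Fact ext_mul1r : right_id (ext_in 1) ext_mul.
Proof.
move=> x; rewrite {1}(ext_sum x) ext_mul_suml [RHS]ext_sum; apply: eq_bigr => i _.
by rewrite ext_mulZl ext_inM mulr1.
Qed.

Fact ext_one_neq0 : ext_in 1 != 0.
Proof.
apply/eqP=> /ffunP one0; have /eqP[] := oner_neq0 B.
rewrite (coord_vbasis (memvf 1)) big1 // => i _.
have /eqP := one0 i; rewrite !ffunE fmorph_eq0 => /eqP->.
by rewrite scale0r.
Qed.

HB.instance Definition _ := GRing.Zmodule_isNzRing.Build E
  ext_mulA ext_mul1l ext_mul1r ext_mulDl ext_mulDr ext_one_neq0.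
HB.instance Definition _ := GRing.Lmodule_isLalgebra.Build F E
  (fun c x y => esym (ext_mulZl c x y)).
HB.instance Definition _ := GRing.Lalgebra_isAlgebra.Build F E
  (fun c x y => esym (ext_mulZr c x y)).
HB.instance Definition _ := Algebra_isFalgebra.Build F E.

Lemma form_ext : is_form s (ext_in : B -> E).
Proof.
split=> [|||// |P P0 PD Pj a|].
- exact: ext_inD.
- exact: ext_inZ.
- by move=> x y; rewrite -ext_inM.
- by rewrite (ext_sum a); apply: (big_ind P) => // i _; apply: Pj.
by rewrite [LHS]dimvf -[LHS]/(#|'I_n| * 1)%N card_ord muln1.
Qed.

End ScalarExtension.

Lemma form_exists (k F : fieldType) (s : {rmorphism k -> F}) (B : falgType k) :
  exists A : falgType F, has_form s B A.
Proof. by exists (ext s B), (@ext_in _ _ s B); apply: form_ext. Qed.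

Section TensorForm.
Variables (k F : fieldType) (s : {rmorphism k -> F}).
Variables (B B' : falgType k) (A A' : falgType F) (j : B -> A) (j' : B' -> A').
Hypotheses (jF : is_form s j) (jD' : {morph j' : x y / x + y}).
Hypotheses (jZ' : forall c b, j' (c *: b) = s c *: j' b).
Hypotheses (jM' : {morph j' : x y / x * y}) (j1' : j' 1 = 1).
Local Notation T := (tensor B B').
Local Notation TA := (tensor A A').

(** This map serves twice: with [j'] the inclusion of a form over [k] it gives
    the form of a tensor product, and with [j'] a morphism [Kt -> K] of field
    extensions it gives the form of a base change, over [Kt]. *)
Definition tensor_map (z : T) : TA :=
  \sum_(i < \dim {:B}) pure_tensor (j (vbasis {:B})`_i) (j' (z i)).

Lemma tensor_map_pure b b' :
  tensor_map (pure_tensor b b' : T) = pure_tensor (j b) (j' b').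
Proof.
rewrite (formE jF) pure_tensor_suml; apply: eq_bigr => i _.
by rewrite ffunE jZ' pure_tensorZr pure_tensorZl nth_form_basis.
Qed.

Lemma tensor_mapD : {morph tensor_map : x y / x + y}.
Proof.
move=> x y; rewrite -big_split; apply: eq_bigr => i _.
by rewrite ffunE jD' pure_tensorDr.
Qed.

Lemma tensor_map_sum I r (P : pred I) E :
  tensor_map (\sum_(i <- r | P i) E i) = \sum_(i <- r | P i) tensor_map (E i).
Proof.
apply: (big_morph tensor_map tensor_mapD).
by apply: (addrI (tensor_map 0)); rewrite -tensor_mapD !addr0.
Qed.

Lemma tensor_mapZ c x : tensor_map (c *: x) = s c *: tensor_map x.
Proof.
rewrite /tensor_map scaler_sumr; apply: eq_bigr => i _.
by rewrite ffunE jZ' pure_tensorZr.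
Qed.

Lemma tensor_mapM : {morph tensor_map : x y / x * y}.
Proof.
move=> x y; rewrite (tensor_sum x) mulr_suml !tensor_map_sum mulr_suml.
apply: eq_bigr => i _; move: (x i) => {}x.
rewrite (tensor_sum y) mulr_sumr !tensor_map_sum mulr_sumr.
apply: eq_bigr => l _.
by rewrite pure_tensor_mul !tensor_map_pure pure_tensor_mul (form_morphM jF) jM'.
Qed.

Lemma tensor_map1 : tensor_map 1 = 1.
Proof. by rewrite [LHS]tensor_map_pure (form_morph1 jF) j1'. Qed.

End TensorForm.

Lemma dim_tensor (F : fieldType) (A B : falgType F) :
  \dim {:tensor A B} = (\dim {:A} * \dim {:B})%N.
Proof.
by rewrite [LHS]dimvf -[LHS]/(#|'I_(\dim {:A})| * dim B)%N card_ord !dimvf.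
Qed.

Lemma form_tensor (k F : fieldType) (s : {rmorphism k -> F})
    (B B' : falgType k) (A A' : falgType F) :
  has_form s B A -> has_form s B' A' -> has_form s (tensor B B') (tensor A A').
Proof.
move=> [j jF] [j' jF']; have [jD' jZ' jM' j1' _ _] := jF'.
exists (tensor_map j j'); split.
- exact: (tensor_mapD _ jD').
- exact: (tensor_mapZ _ jZ').
- exact: (tensor_mapM jF jD' jZ' jM').
- exact: (tensor_map1 jF jZ' j1').
- move=> P P0 PD Pj a; rewrite (tensor_sum a); apply: (big_ind P) => // i _.
  move: (_`_i) (a i) => {a i} x y.
  apply: (form_span jF (P := fun x => P (pure_tensor x y))) x.
  + by rewrite pure_tensor0l.
  + by move=> x x' Px Px'; rewrite pure_tensorDl; apply: PD.
  move=> c b; apply: (form_span jF' (P := fun y => P (pure_tensor _ y))) y.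
  + by rewrite -(scale0r 0) pure_tensorZr scale0r.
  + by move=> y y' Py Py'; rewrite pure_tensorDr; apply: PD.
  move=> d b'; rewrite pure_tensorZl pure_tensorZr scalerA.
  by rewrite -(tensor_map_pure jF jZ').
by rewrite !dim_tensor (form_dim jF) (form_dim jF').
Qed.

Lemma form_base_change (k F : fieldType) (s : {rmorphism k -> F})
    (Kt : fieldExtType k) (K : fieldExtType F) (t : {rmorphism Kt -> K})
    (B : falgType k) (A : falgType F) :
    (forall c x, t (c *: x) = s c *: t x) -> has_form s B A ->
  has_form t (base_change B Kt) (base_change A K).
Proof.
move=> tZ [j jF]; exists (tensor_map j t : base_change B Kt -> base_change A K).
split.
- exact: (tensor_mapD j (rmorphD t)).
- move=> c x; rewrite /tensor_map; apply/esym.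
  rewrite scaler_sumr; apply: eq_bigr => i _.
  by rewrite base_change_pure ffunE rmorphM.
- exact: (tensor_mapM jF (rmorphD t) tZ (rmorphM t)).
- exact: (tensor_map1 jF tZ (rmorph1 t)).
- move=> P P0 PD Pj a; rewrite (tensor_sum a); apply: (big_ind P) => // i _.
  move: (_`_i) (a i) => {a i} x y.
  apply: (form_span jF (P := fun x => P (pure_tensor x y))) x.
  + by rewrite pure_tensor0l.
  + by move=> x x' Px Px'; rewrite pure_tensorDl; apply: PD.
  move=> c b; rewrite pure_tensorZl -pure_tensorZr.
  rewrite -[c *: y]mulr1 -base_change_pure -(rmorph1 t).
  by rewrite -(tensor_map_pure jF tZ); apply: Pj.
have dimE (L : fieldType) (C : falgType L) (M : fieldExtType L) :
    \dim {:base_change C M} = \dim {:C}.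
  by rewrite dimvf -[LHS]/(#|'I_(\dim {:C})| * 1)%N card_ord muln1.
by rewrite !dimE (form_dim jF).
Qed.

(** * The valuation of a form of a division algebra *)

Section ValueGroupTheory.
Variable G : ordered_group.
Implicit Types x y z : option G.

Lemma vle_refl x : vle x x. Proof. by case: x => /=. Qed.

Lemma vle_trans x y z : vle x y -> vle y z -> vle x z.
Proof. by case: x y z => [x|] [y|] [z|] //=; apply: le_trans. Qed.

Lemma vle_anti x y : vle x y -> vle y x -> x = y.
Proof.
case: x y => [x|] [y|] //= le_xy le_yx; congr Some.
by apply: le_anti; rewrite le_xy.
Qed.

Lemma vle_total x y : vle x y || vle y x.
Proof. by case: x y => [x|] [y|] //=; apply: ordered_group_total. Qed.

Lemma vle_min z x y : vle z (vmin x y) = vle z x && vle z y.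
Proof.
rewrite /vmin; case: ifP => [le_xy | /negbT nle_xy].
  by case zx: (vle z x) => //=; rewrite (vle_trans zx le_xy).
have le_yx: vle y x by move: (vle_total x y); rewrite (negPf nle_xy).
by case zy: (vle z y); rewrite ?andbF // (vle_trans zy le_yx).
Qed.

Lemma vaddC x y : vadd x y = vadd y x.
Proof. by case: x y => [x|] [y|] //=; rewrite addrC. Qed.
Lemma vaddx0 x : vadd x (Some 0) = x.
Proof. by case: x => [x|] //=; rewrite addr0. Qed.

Lemma vle_add2l z x y : vle x y -> vle (vadd z x) (vadd z y).
Proof.
case: z x y => [z|] [x|] [y|] //= le_xy.
by rewrite ![z + _]addrC; apply: ordered_group_leD.
Qed.

Lemma vle_bigmin n (f : 'I_n -> option G) z :
  vle z (\big[@vmin G/None]_i f i) <-> forall i, vle z (f i).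
Proof.
split=> [le_z i | le_z]; last by elim/big_ind: _ => // x y; rewrite vle_min => ->.
elim: (index_enum _) le_z (mem_index_enum i) => // l r IHr.
by rewrite big_cons vle_min inE => /andP[zl /IHr{}IHr] /orP[/eqP-> | ] //.
Qed.

Lemma bigmin_attained n (f : 'I_n -> option G) :
  \big[@vmin G/None]_i f i = None \/ exists i, \big[@vmin G/None]_i f i = f i.
Proof.
elim/big_ind: _ => [|x y Hx Hy|i _]; [by left | | by right; exists i].
by rewrite /vmin; case: ifP.
Qed.

End ValueGroupTheory.

Section ValuationTheory.
Variables (R : nzRingType) (G : ordered_group) (v : valuation R G).

Lemma valuation0 : v 0 = None. Proof. exact/valuation_eq0. Qed.

Lemma valuation1 : v 1 = Some 0.
Proof.
case v1: (v 1) => [a|]; last by have /eqP := (valuation_eq0 v 1).1 v1; rewrite oner_eq0.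
have := valuationM v 1 1; rewrite mulr1 v1 => -[/esym/eqP].
by rewrite -subr_eq0 addrK => /eqP->.
Qed.

Lemma val_ringE x : (x \in val_ring v) = vle (Some 0) (v x). Proof. by []. Qed.

Lemma val_ring0 : 0 \in val_ring v. Proof. by rewrite val_ringE valuation0. Qed.

End ValuationTheory.

Section FormValuation.
Variables (F k : fieldType) (G : ordered_group) (v : valuation F G) (pi : F -> k).
Hypothesis v_pi : residue_map v pi.
Variable s : {rmorphism k -> F}.
Hypotheses (s_val : forall c, s c \in val_ring v) (pi_s : cancel s pi).
Variables (B : falgType k) (A : falgType F) (j : B -> A).
Hypotheses (divB : is_division B) (jF : is_form s j).
Local Notation n := (\dim {:B}).
Local Notation e := (vbasis {:B}).

Definition form_val_fun (x : A) : option G :=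
  \big[@vmin G/None]_(i < n) v (form_coord j i x).
Local Notation w := form_val_fun.

Definition form_residue (x : A) : B := \sum_(i < n) pi (form_coord j i x) *: e`_i.

Lemma vle_form_val z x : vle z (w x) <-> forall i, vle z (v (form_coord j i x)).
Proof. exact: vle_bigmin. Qed.

Lemma form_val_le x i : vle (w x) (v (form_coord j i x)).
Proof. by move: i; apply/vle_form_val/vle_refl. Qed.

Lemma form_val_attained x : w x = None \/ exists i, w x = v (form_coord j i x).
Proof. exact: bigmin_attained. Qed.

Lemma form_val_eq0 x : w x = None <-> x = 0.
Proof.
split=> [wx0 | ->].
  apply: (form_coord_inj jF) => i; rewrite [RHS]raddf0.
  by apply/(valuation_eq0 v); have := form_val_le x i; rewrite wx0; case: (v _).
have [//|[i ->]] := form_val_attained 0.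
by rewrite [form_coord j i 0]raddf0 valuation0.
Qed.

Lemma form_valD x y : vle (vmin (w x) (w y)) (w (x + y)).
Proof.
apply/vle_form_val => i; rewrite form_coordD.
apply: vle_trans (valuationD v _ _); rewrite vle_min.
have := vle_refl (vmin (w x) (w y)); rewrite vle_min => /andP[le_x le_y].
by rewrite (vle_trans le_x) ?(vle_trans le_y) ?form_val_le.
Qed.

Lemma form_valZ c x : w (c *: x) = vadd (v c) (w x).
Proof.
apply: vle_anti.
  have [|[i]] := form_val_attained x.
    by move=> ->; rewrite vaddC.
  move=> ->; rewrite -valuationM -form_coordZ; exact: form_val_le.
apply/vle_form_val => i; rewrite form_coordZ valuationM.
exact/vle_add2l/form_val_le.
Qed.

(** Reduction as a relation, so that integrality and the value of the residue
    go together through sums and products. *)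
Definition reduces_to (x : A) (b : B) : Prop :=
  vle (Some 0) (w x) /\ form_residue x = b.

Lemma form_val_ring x :
  vle (Some 0) (w x) <-> forall i, form_coord j i x \in val_ring v.
Proof. exact: vle_form_val. Qed.

Lemma reduces_toD x y b c :
  reduces_to x b -> reduces_to y c -> reduces_to (x + y) (b + c).
Proof.
move=> [Ox <-] [Oy <-]; split.
  by apply: vle_trans (form_valD x y); rewrite vle_min Ox.
rewrite -big_split; apply: eq_bigr => i _ /=; rewrite -scalerDl form_coordD.
by rewrite (residueD v_pi) //; [move/form_val_ring: Ox | move/form_val_ring: Oy]; apply.
Qed.

Lemma pi_val0 : pi 0 = 0.
Proof.
apply/(residue_ker v_pi); first exact: val_ring0.
by rewrite inE valuation0.
Qed.

Lemma reduces_to0 : reduces_to 0 0.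
Proof.
split; first by rewrite (form_val_eq0 0).2.
rewrite /form_residue big1 // => i _.
by rewrite [form_coord j i 0]raddf0 pi_val0 scale0r.
Qed.

Lemma reduces_to_sum I r (P : pred I) (x : I -> A) (b : I -> B) :
    (forall i, reduces_to (x i) (b i)) ->
  reduces_to (\sum_(i <- r | P i) x i) (\sum_(i <- r | P i) b i).
Proof.
move=> xb; apply: (big_rec2 reduces_to) => [|i y c _]; first exact: reduces_to0.
exact: reduces_toD.
Qed.

Lemma reduces_toZ a x b :
  a \in val_ring v -> reduces_to x b -> reduces_to (a *: x) (pi a *: b).
Proof.
move=> Oa [Ox <-]; split.
  rewrite form_valZ; apply: vle_trans Oa _; rewrite -{1}[v a]vaddx0.
  exact: vle_add2l.
rewrite /form_residue scaler_sumr; apply: eq_bigr => i _.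
rewrite form_coordZ (residueM v_pi) ?scalerA //.
by move/form_val_ring: Ox; apply.
Qed.

Lemma reduces_to_form b : reduces_to (j b) b.
Proof.
split; first by apply/form_val_ring => i; rewrite (form_coordE jF).
rewrite [RHS](coord_vbasis (memvf b)); apply: eq_bigr => i _.
by rewrite (form_coordE jF) pi_s.
Qed.

Lemma reduces_toM x y b c :
  reduces_to x b -> reduces_to y c -> reduces_to (x * y) (b * c).
Proof.
move=> [Ox <-] [Oy <-]; rewrite {1}(form_expand jF x) /form_residue !mulr_suml.
apply: reduces_to_sum => i; rewrite -!scalerAl; apply: reduces_toZ.
  by move/form_val_ring: Ox; apply.
rewrite {1}(form_expand jF y) !mulr_sumr; apply: reduces_to_sum => l.
rewrite -!scalerAr -(form_morphM jF); apply: reduces_toZ; last exact: reduces_to_form.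
by move/form_val_ring: Oy; apply.
Qed.

Lemma form_residue_eq0 x : vle (Some 0) (w x) ->
  (form_residue x = 0) <-> vlt (Some 0) (w x).
Proof.
move=> Ox; have Oxi := (form_val_ring x).1 Ox; split=> [res0 | gt0].
  have: forall i, vlt (Some 0) (v (form_coord j i x)).
    move=> i; apply/(residue_ker v_pi) => //.
    have := congr1 (coord e i) res0; rewrite raddf0.
    by rewrite coord_sum_free ?(basis_free (vbasisP _)).
  move=> gt0; have [|[i]] := form_val_attained x.
    by move=> ->.
  by move=> ->.
rewrite /form_residue big1 // => i _.
suffices ->: pi (form_coord j i x) = 0 by rewrite scale0r.
apply/(residue_ker v_pi) => //; rewrite inE /vlt.
by apply: contra gt0; apply: vle_trans (form_val_le x i).
Qed.

Lemma form_val_unit x b : reduces_to x b -> b != 0 -> w x = Some 0.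
Proof.
move=> [Ox <-] nz_b; apply: vle_anti (Ox); apply: contraR nz_b => gt0.
exact/eqP/(form_residue_eq0 Ox).
Qed.

(** After division by coordinates of minimal value, both factors have nonzero
    residue; so has their product, the residue algebra [B] being division. *)
Lemma form_valM x y : w (x * y) = vadd (w x) (w y).
Proof.
have [->|nz_x] := eqVneq x 0; first by rewrite mul0r !((form_val_eq0 0).2).
have [->|nz_y] := eqVneq y 0.
  by rewrite mulr0 !((form_val_eq0 0).2) // vaddC.
have normalize z : z != 0 -> exists c b z',
    [/\ z = c *: z', w z = v c, reduces_to z' b & b != 0].
  move=> nz_z; have [|[i]] := form_val_attained z.
    by move/form_val_eq0/eqP; rewrite (negPf nz_z).
  set c := form_coord j i z => wz.
  have nz_c: c != 0.
    by apply: contraNneq nz_z => c0; apply/eqP/form_val_eq0; rewrite wz c0 valuation0.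
  have wz': w (c^-1 *: z) = Some 0.
    by rewrite form_valZ wz -valuationM mulVf // valuation1.
  exists c, (form_residue (c^-1 *: z)), (c^-1 *: z); split=> //.
  - by rewrite scalerA divff ?scale1r.
  - by split=> //; rewrite wz' vle_refl.
  apply/eqP=> /form_residue_eq0; rewrite wz' => gt0.
  by have := gt0 (vle_refl _); rewrite /vlt vle_refl.
have [c [b [x' [-> -> x'b nz_b]]]] := normalize x nz_x.
have [d [b' [y' [-> -> y'b nz_b']]]] := normalize y nz_y.
rewrite -scalerAl -scalerAr scalerA form_valZ valuationM.
rewrite (form_val_unit (reduces_toM x'b y'b)) ?vaddx0 //.
by apply/eqP=> /(division_domain divB)[] /eqP; apply/negP.
Qed.

Definition form_val : valuation A G :=
  Valuation form_val_eq0 form_valM form_valD.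

Lemma form_val_division : is_division A.
Proof.
apply: domain_division => x y /form_val_eq0; rewrite form_valM.
case wx: (w x) => [a|]; last by left; apply/form_val_eq0.
by case wy: (w y) => [b|] //; right; apply/form_val_eq0.
Qed.

Lemma form_val_extends : val_extends v form_val.
Proof.
exists idfun; split=> // a; rewrite /= form_valZ -(form_morph1 jF).
rewrite (form_val_unit (reduces_to_form 1)) ?oner_neq0 // vaddx0.
by case: (v a).
Qed.

Lemma form_residueP : residue_map form_val form_residue.
Proof.
have red x : x \in val_ring form_val -> reduces_to x (form_residue x) by [].
split.
- by rewrite -(form_morph1 jF); case: (reduces_to_form 1).
- by move=> x y /red Ox /red Oy; case: (reduces_toD Ox Oy).
- by move=> x y /red Ox /red Oy; case: (reduces_toM Ox Oy).
- by move=> x; apply: form_residue_eq0.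
by move=> b; exists (j b); case: (reduces_to_form b).
Qed.

Lemma form_residue_compat :
  {in val_ring v, forall a, form_residue a%:A = (pi a)%:A}.
Proof.
move=> a Oa; rewrite -(form_morph1 jF).
by case: (reduces_toZ Oa (reduces_to_form 1)).
Qed.

Lemma form_inertial : center_separable B -> inertial_over v pi form_val form_residue.
Proof.
move=> sepB; split=> //.
- exact: form_val_division.
- exact: form_val_extends.
- exact: form_residueP.
- exact: form_residue_compat.
exact: form_dim jF.
Qed.

End FormValuation.

(** * Field extensions *)

Section CenterSeparable.
Variable k : fieldType.

Lemma center_separable_central (B : falgType k) :
  is_central B -> center_separable B.
Proof.
move=> cB; pose f : {lrmorphism k^o -> B} :=
  HB.pack (in_alg B : k^o -> B)
    (GRing.isZmodMorphism.Build k^o B (in_alg B) (rmorphB (in_alg B)))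
    (GRing.isMonoidMorphism.Build k^o B (in_alg B)
      (conj (rmorph1 (in_alg B)) (rmorphM (in_alg B))))
    (GRing.isScalable.Build k k^o B *:%R (in_alg B)
      (fun c x => esym (scalerA c x 1))).
exists k^o, f; split; last by rewrite regular_fullv; apply: separable_refl.
move=> x; rewrite cB; split=> [/vlineP[c ->] | [c <-]]; first by exists c.
by rewrite -[f c]/(c *: 1) memvZ // memv_line.
Qed.

Lemma center_separable_field (L : fieldExtType k) :
  separable 1 {:L} -> center_separable L.
Proof.
move=> sepL; exists L, (@idfun L); split=> // x; split=> _; first by exists x.
by rewrite memv_cap memvf; apply/centvP=> y _; apply: mulrC.
Qed.

End CenterSeparable.

Lemma division_field (F : fieldType) (A : falgType F) :
  commutative (@GRing.mul A) -> is_division A ->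
  exists K : fieldExtType F, isomorphic A K.
Proof.
move=> mulAC divA.
pose mixC := GRing.PzRing_hasCommutativeMul.Build A mulAC.
pose cA : comUnitRingType := HB.pack (A : Type) A mixC.
pose mixF := GRing.ComUnitRing_isField.Build cA divA.
pose K : fieldExtType F := HB.pack (A : Type) A mixC mixF.
exists K; apply: (iso_of_bij (f := (id : A -> K))) => //; by exists id.
Qed.

Section GaloisLift.
Variables (k F : fieldType) (s : {rmorphism k -> F}).
Variables (Kt : splittingFieldType k) (K : fieldExtType F) (j : {rmorphism Kt -> K}).
Hypothesis jF : is_form s j.

(** An element of [<<1 & r>>] is an iterated polynomial in the entries of [r],
    and [j] acts on the coefficients of polynomials. *)
Lemma form_adjoin (r : seq Kt) a :
  a \in <<1 & r>>%VS -> j a \in <<1 & [seq j x | x <- r]>>%VS.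
Proof.
elim/last_ind: r a => [|r x IHr] a.
  rewrite !adjoin_nil !subfield_closed => /vlineP[c ->].
  by rewrite (form_morphZ jF) rmorph1 memvZ // memv_line.
rewrite map_rcons !adjoin_rcons => /Fadjoin_polyP[p /polyOverP rp ->].
rewrite -horner_map; apply: mempx_Fadjoin.
by apply/polyOverP=> i; rewrite coef_map; apply: IHr.
Qed.

(** The generating separable polynomial of [Kt] splits in [K], and its roots
    still generate since [K] is spanned by the image of [Kt]. *)
Lemma form_galois_poly : galois 1 {:Kt} ->
  exists p : {poly K}, [/\ p \is a polyOver 1%VS, separable_poly p
                         & splittingFieldFor 1 p {:K}].
Proof.
case/splitting_galoisField=> p [Kp sep_p [r Dp defKt]].
exists (map_poly j p); split.
- have /polyOver1P[q ->] := Kp; apply/polyOver1P; exists (map_poly s q).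
  rewrite -!map_poly_comp; apply: eq_map_poly => c /=.
  by rewrite (form_morphZ jF) rmorph1.
- by rewrite separable_map.
exists [seq j x | x <- r].
  move: Dp; rewrite -(eqp_map j) big_map; congr (_ %= _).
  by rewrite rmorph_prod; apply: eq_bigr => x _; rewrite /= map_polyXsubC.
apply/eqP; rewrite eqEsubv subvf; apply/subvP=> a _.
apply: (form_span jF (P := fun a => a \in _)) a => [|x y|c b].
- exact: mem0v.
- exact: memvD.
by rewrite memvZ // form_adjoin // defKt memvf.
Qed.

End GaloisLift.

(** * The inertial lift property *)

Section CentralSimple.
Variable F : fieldType.
Implicit Types A B D : falgType F.

Lemma central_simpleP A : central_simple A <-> is_central A /\ ring_simple A.
Proof. by split=> -[cA /is_simpleP sA]. Qed.

Lemma central_division_simple D : central_division D -> central_simple D.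
Proof.
by case=> divD cD; apply/central_simpleP; split=> //; apply: division_ring_simple.
Qed.

Lemma central_simple_matalg n A : central_simple A -> central_simple (matalg n A).
Proof.
move=> /central_simpleP[cA sA]; apply/central_simpleP.
by split; [apply: (matalg_central n A).1 | apply: matalg_simple].
Qed.

Lemma central_simple_tensor A B :
  central_simple A -> central_simple B -> central_simple (tensor A B).
Proof.
move=> /central_simpleP[cA sA] /central_simpleP[cB sB]; apply/central_simpleP.
by split; [apply: tensor_central | apply: tensor_simple].
Qed.

Lemma central_simple_opp A : central_simple A -> central_simple A^c.
Proof.
move=> /central_simpleP[/centralP cA sA]; apply/central_simpleP; split.
  by apply/centralP=> z cz; apply: cA => a; apply/esym/cz.
move=> x /sA[s s1]; exists [seq (t.2, t.1) | t <- s].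
rewrite -[RHS]s1 /sandwich big_map; apply: eq_bigr => t _.
exact: (mulrA (t.1 : A) (x : A) (t.2 : A)).
Qed.

Lemma central_simple_regular : central_simple F^o.
Proof.
apply: central_division_simple; split; first by move=> x; rewrite unitfE.
by apply/centralP=> z _; exists z; rewrite [RHS]mulr1.
Qed.

Lemma wedderburn_central A : central_simple A ->
  exists n D, central_division D /\ isomorphic (matalg n D) A.
Proof.
move=> /central_simpleP[cA /wedderburn[n [D [divD isoA]]]].
exists n, D; do 2!split=> //.
exact: (matalg_central n D).2 (iso_central (iso_sym isoA) cA).
Qed.

(** [E] and [A'] are both corners of one matrix algebra over [A']. *)
Lemma brauer_equiv_matalg A A' (E : falgType F) n :
    is_division E -> ring_simple A' -> isomorphic (matalg n E) A ->
    brauer_equiv A A' ->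
  exists m, isomorphic (matalg m E) A'.
Proof.
move=> divE sA' [f [fC _]] /brauer_equivP[m [p [g [gC _]]]].
have qC := corner_map_comp (corner_elem_mx n E) fC.
have {}qC := corner_map_comp qC (corner_elem_mx m A).
have {}qC := corner_map_comp qC gC.
exact: (corner_matrix (matalg_simple (n := p) sA') divE qC (corner_elem_mx p A')).
Qed.

Lemma iso_matalg0 A : isomorphic A (matalg 0 A).
Proof.
exists (@elem_mx 0 F A ord0 ord0); split; first exact: corner_elem_mx.
by apply/matrixP=> i j; rewrite !ord1 elem_mx_id matalg1.
Qed.

End CentralSimple.

Lemma form_commutative (k F : fieldType) (s : {rmorphism k -> F})
    (B : falgType k) (A : falgType F) (j : B -> A) :
  is_form s j -> commutative (@GRing.mul B) -> commutative (@GRing.mul A).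
Proof.
move=> jF mulBC x y.
apply: (form_span jF (P := fun x => x * y = y * x)) x => [|x x' xy x'y|c b].
- by rewrite mulr0 mul0r.
- by rewrite mulrDl mulrDr xy x'y.
apply: (form_span jF (P := fun y => _ * y = y * _)) y => [|y y' xy xy'|d b'].
- by rewrite mulr0 mul0r.
- by rewrite mulrDl mulrDr xy xy'.
by rewrite -!scalerAl -!scalerAr -!(form_morphM jF) mulBC !scalerA mulrC.
Qed.

Section InertialLift.
Variables (F : fieldType) (G : ordered_group) (v : valuation F G).
Variables (k : fieldType) (pi : F -> k) (v_pi : residue_map v pi).
Variable s : {rmorphism k -> F}.
Hypotheses (s_val : forall c, s c \in val_ring v) (pi_s : cancel s pi).

(** The classes in the image of the scalar extension map [Br(k) -> Br(F)]. *)
Definition lifted (A : falgType F) : Prop :=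
  central_simple A /\ exists B : falgType k, central_simple B /\ has_form s B A.

(** [A'] is a matrix algebra over the division algebra [E = D (x)_k F] which
    underlies [A], hence is itself extended from a matrix algebra over [D]. *)
Lemma lifted_equiv A A' :
  lifted A -> central_simple A' -> brauer_equiv A A' -> lifted A'.
Proof.
move=> [csA [B [/wedderburn_central[n [D [cdD isoB]]] formA]]] csA' eqAA'.
have [E [j jF]] := form_exists s D.
have divE: is_division E := form_val_division v_pi s_val pi_s cdD.1 jF.
have isoA: isomorphic (matalg n E) A.
  by apply: form_unique (form_isol isoB formA); apply: form_matalg; exists j.
have [_ sA'] := (central_simpleP A').1 csA'.
have [m isoA'] := brauer_equiv_matalg divE sA' isoA eqAA'.
split=> //; exists (matalg m D); split.
  exact/central_simple_matalg/central_division_simple.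
by apply: form_isor isoA' _; apply: form_matalg; exists j.
Qed.

Lemma lifted_subgroup : brauer_subgroup lifted.
Proof.
split.
- by move=> A [].
- exact: lifted_equiv.
- split; first exact: central_simple_regular.
  by exists k^o; split; [apply: central_simple_regular | apply: form_regular].
- move=> A A' [csA [B [csB formA]]] [csA' [B' [csB' formA']]].
  split; first exact: central_simple_tensor.
  by exists (tensor B B'); split; [apply: central_simple_tensor | apply: form_tensor].
move=> A [csA [B [csB formA]]]; split; first exact: central_simple_opp.
by exists B^c; split; [apply: central_simple_opp | apply: form_opp].
Qed.

(** The form [B] is the residue algebra of [D]. *)
Lemma form_in_IBr (D : falgType F) (B : falgType k) :
  central_division D -> is_division B -> is_central B -> has_form s B D ->
  in_IBr v pi D B.
Proof.
move=> cdD divB cB [j jF]; split=> //.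
exists G, (form_val v_pi s_val pi_s divB jF), (form_residue pi j).
exact/form_inertial/center_separable_central.
Qed.

Lemma lifted_in_IBr D :
  central_division D -> lifted D -> exists Dbar, in_IBr v pi D Dbar.
Proof.
move=> cdD [_ [B [[cB _] formBD]]]; exists B; apply: form_in_IBr => //.
by have [j jF] := formBD; apply: form_division jF cdD.1.
Qed.

Lemma lifted_onto B : central_simple B ->
  exists D Dbar, [/\ lifted D, in_IBr v pi D Dbar & brauer_equiv Dbar B].
Proof.
case/wedderburn_central=> n [Dbar [cdDbar isoB]].
have [divDbar cDbar] := cdDbar; have csDbar := central_division_simple cdDbar.
have [D formBD] := form_exists s Dbar; exists D, Dbar.
have cdD: central_division D.
  have [j jF] := formBD; split.
    exact: (form_val_division v_pi s_val pi_s divDbar jF).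
  by apply: form_central jF cDbar _; apply: division_ring_simple.
split.
- by split; [apply: central_division_simple | exists Dbar].
- exact: form_in_IBr.
apply/brauer_equivP; exists n, 0.
exact: iso_trans isoB (iso_matalg0 B).
Qed.

Lemma lifted_galois (Kt : splittingFieldType k) : galois 1 {:Kt} ->
  exists (K : splittingFieldType F) (H : ordered_group)
         (w : valuation K H) (piK : K -> Kt),
  [/\ galois 1 {:K}, inertial_over v pi w piK
    & forall D, central_division D -> lifted D ->
        exists DK : falgType K,
          underlying_division (base_change D K) DK /\
          exists (H' : ordered_group) (w' : valuation DK H'),
            val_extends w w'].
Proof.
move=> galKt; have divKt: is_division Kt by move=> x; rewrite unitfE.
have [E [j0 j0F]] := form_exists s Kt.
have divE := form_val_division v_pi s_val pi_s divKt j0F.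
have [K0 isoK0] := division_field (form_commutative j0F (@mulrC Kt)) divE.
have [j jF] := form_isor isoK0 (ex_intro _ j0 j0F).
have jB: {morph j : x y / x - y}.
  by move=> x y; apply: (addIr (j y)); rewrite -(form_morphD jF) !subrK.
pose t0 : {rmorphism Kt -> K0} := HB.pack j
  (GRing.isZmodMorphism.Build Kt K0 j jB)
  (GRing.isMonoidMorphism.Build Kt K0 j (conj (form_morph1 jF) (form_morphM jF))).
have [p [Kp sep_p splitp]] := form_galois_poly (j := t0) jF galKt.
pose K : splittingFieldType F := HB.pack K0
  (FieldExt_isSplittingField.Build F K0 (ex_intro2 _ _ p Kp splitp)).
pose t : {rmorphism Kt -> K} := t0.
have tF: is_form s (t : Kt -> K) := jF.
exists K, G, (form_val v_pi s_val pi_s divKt tF), (form_residue pi t); split.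
- by apply/splitting_galoisField; exists p.
- apply/form_inertial/center_separable_field.
  by case/and3P: galKt.
move=> D _ [_ [B [/central_simpleP[cB sB] formBD]]].
(* D (x)_F K = (B (x)_k Kt) (x)_Kt K = M_(n+1)(C) (x)_Kt K *)
have sBK: ring_simple (base_change B Kt).
  by apply: (tensor_simple (A := B) (B := Kt)) => //; apply: division_ring_simple.
have [n [C [divC isoC]]] := wedderburn sBK.
have formBDK := form_base_change (t := t) (form_morphZ tF) formBD.
have [DK formC] := form_exists t C; exists DK.
have [l lF] := formC.
(* the valued field K, with residue field Kt and residue section t *)
set w := form_val _ _ _ _ _; pose piK := form_residue pi t.
have w_pi: residue_map w piK by apply: form_residueP.
have t_val c : t c \in val_ring w.
  by case: (reduces_to_form s_val pi_s tF c).
have pi_t: cancel t piK by move=> c; case: (reduces_to_form s_val pi_s tF c).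
split; last first.
  by exists G, (form_val w_pi t_val pi_t divC lF); apply: form_val_extends.
split; first exact: (form_val_division w_pi t_val pi_t divC lF).
apply/matrix_overP; exists n.
apply: form_unique (form_isol isoC formBDK).
exact: form_matalg.
Qed.

Lemma lift_inertial : inertial_lift_property v pi.
Proof.
exists lifted; split.
- exact: lifted_subgroup.
- exact: lifted_in_IBr.
- exact: lifted_onto.
exact: lifted_galois.
Qed.

End InertialLift.

(** [pi] is additive and multiplicative on [L], where it is injective: values
    of [s] are compared by applying [pi]. *)
Lemma residue_section (F : fieldType) (G : ordered_group) (v : valuation F G)
    (k : fieldType) (pi : F -> k) (v_pi : residue_map v pi)
    (L : {pred F}) (L_field : divring_closed L)
    (L_sub : {subset L <= val_ring v}) (pi_inj : {in L &, injective pi})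
    (pi_onto : forall y : k, exists2 x, x \in L & pi x = y) :
  exists s : {rmorphism k -> F}, (forall c, s c \in L) /\ cancel s pi.
Proof.
have [L1 LB LV] := L_field.
have ex_s y : exists x, (x \in L) && (pi x == y).
  by have [x Lx <-] := pi_onto y; exists x; rewrite Lx eqxx.
pose s y := xchoose (ex_s y).
have [Ls sK]: (forall c, s c \in L) /\ cancel s pi.
  by split=> c; have /andP[Lx /eqP] := xchooseP (ex_s c).
have sB: {morph s : x y / x - y}.
  move=> x y; apply: pi_inj; rewrite ?LB // sK.
  apply: (addIr (pi (s y))); rewrite -(residueD v_pi) ?subrK ?sK ?subrK //.
    exact/L_sub/LB.
  exact: L_sub.
have LM: {in L &, forall x y, x * y \in L} := (GRing.divr_closedM L_field).2.
have sM: monoid_morphism s.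
  split=> [|x y]; first by apply: pi_inj; rewrite // sK (residue1 v_pi).
  by apply: pi_inj; rewrite ?LM // (residueM v_pi) ?sK //; apply: L_sub.
pose sR : {rmorphism k -> F} := HB.pack s
  (GRing.isZmodMorphism.Build k F s sB) (GRing.isMonoidMorphism.Build k F s sM).
by exists sR.
Qed.

Theorem theorem2p16 (F : fieldType) (G : ordered_group) (v : valuation F G)
    (k : fieldType) (pi : F -> k) (v_pi : residue_map v pi)
    (L : {pred F}) (L_field : divring_closed L)
    (L_sub : {subset L <= val_ring v}) (pi_inj : {in L &, injective pi})
    (pi_onto : forall y : k, exists2 x, x \in L & pi x = y) :
  inertial_lift_property v pi.
Proof.
have [s [Ls sK]] := residue_section v_pi L_field L_sub pi_inj pi_onto.
by apply: (lift_inertial v_pi _ sK) => c; apply/L_sub/Ls.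
Qed.
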